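(* Let $K$ be an algebraically closed field. Every semisimple super Cardy-Frobenius algebra over $K$ is a direct sum of elementary Cardy-Frobenius algebras, i.e. of algebras of the types (E1), (E2), (E3) described in the context.
   Context: All algebras are associative over $K$. $E$ denotes the identity matrix. For a $\mathbb{Z}/2\mathbb{Z}$-graded space $V=V_0\oplus V_1$ and an endomorphism $T$ of $V$, $\operatorname{str}(T)$ is the supertrace, i.e. the trace of the $V_0\to V_0$ component minus the trace of the $V_1\to V_1$ component. $|X|\in\{0,1\}$ is the degree of a homogeneous element $X$. A *super Cardy-Frobenius algebra* $(A,B,\theta_A,\theta_B,\tau^*,\tau_* )$ consists of: 1) a commutative (in the super sense) finite-dimensional unital $\mathbb{Z}/2\mathbb{Z}$-graded algebra $A$ (bulk algebra) and a finite-dimensional unital $\mathbb{Z}/2\mathbb{Z}$-graded algebra $B$ (boundary algebra; the zero algebra is allowed); 2) linear forms $\theta_A:A\to K$, $\theta_B:B\to K$ such that the bilinear forms $\langle X,Y\rangle_A=\theta_A(XY)$ and $\langle X,Y\rangle_B=\theta_B(XY)$ are nondegenerate and symmetric in the sense that $\theta(XY)=(-1)^{|X||Y|}\theta(YX)$ for homogeneous $X,Y$; 3) a homomorphism of unital algebras $\tau_*:A\to B$ that preserves the grading and maps $A$ into the center of $B$; 4) a linear map $\tau^*:B\to A$, conjugate (adjoint) to $\tau_*$ with respect to the bilinear forms, i.e. $\langle \tau_*(a),b\rangle_B=\langle a,\tau^*(b)\rangle_A$, which either preserves or reverses the grading; 5) (Cardy condition) $\langle\tau^*(X),\tau^*(Y)\rangle_A=\operatorname{str}_K(m_{X,Y})$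 for any $X,Y\in B$, where $m_{X,Y}:B\to B$ is the map $f\mapsto(-1)^{|X||Y|+|X||f|}\,Y f X$ (written for homogeneous $X,Y,f$ and extended linearly). It is *semisimple* if $A$ and $B$ are semisimple in the category of $\mathbb{Z}/2\mathbb{Z}$-graded algebras. The *direct sum* of $(A_i,B_i,\theta_{A_i},\theta_{B_i},\tau^*_i,\tau_{i*})$, $i=1,2$, has bulk algebra $A_1\oplus A_2$, boundary algebra $B_1\oplus B_2$, forms $\theta_{A_1\oplus A_2}(a_1\oplus a_2)=\theta_{A_1}(a_1)+\theta_{A_2}(a_2)$ and $\theta_{B_1\oplus B_2}(b_1\oplus b_2)=\theta_{B_1}(b_1)+\theta_{B_2}(b_2)$, and maps $\tau^*(b_1\oplus b_2)=\tau_1^*(b_1)+\tau_2^*(b_2)$, $\tau_*(a_1\oplus a_2)=\tau_{1*}(a_1)+\tau_{2*}(a_2)$; similarly for more summands. $\operatorname{Mat}(n)$ is the algebra of $n\times n$ matrices over $K$. $\operatorname{Mat}(n|m)$ is the $\mathbb{Z}/2\mathbb{Z}$-graded algebra of endomorphisms of the graded space $K^{n|m}$. $Q(n)=\operatorname{Mat}(n)[\xi]$, where $\operatorname{Mat}(n)$ is even, $|\xi|=1$, $\xi$ commutes with $\operatorname{Mat}(n)$ and $\xi^2=1$. The *elementary* Cardy-Frobenius algebras are the following. (E1) $A=K$, $B=0$, $\theta_A(1)=\lambda\neq 0$. (E2) $A=K$, $B=\operatorname{Mat}(n|m)$, $\theta_A(x)=\lambda x$, $\theta_B(X)=\mu\operatorname{str}(X)$,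 $\tau_*(x)=xE$, $\tau^*(X)=\frac{\mu}{\lambda}\operatorname{str}(X)$, with $\lambda,\mu\in K^\times$ and $\lambda=\mu^2$. (E3) $A=K$, $B=Q(n)$, $\theta_A(x)=\lambda x$, $\theta_B(X+Y\xi)=\mu\operatorname{tr}(Y)$, $\tau_*(x)=xE$, $\tau^*(X+Y\xi)=\frac{\mu}{\lambda}\operatorname{tr}(Y)$ for $X,Y\in\operatorname{Mat}(n)$, with $\lambda,\mu\in K^\times$ and $\lambda=\frac12\mu^2$.
   Formalization: In (E3) the relation λ = ½μ² is replaced by λ = −½μ², which the stated Cardy condition forces (on Q(1), str m_{ξ,ξ} = −2), and K is assumed of characteristic ≠ 2, since ½ is undefined and the claim fails in characteristic 2. *)

(* Defs.v *)
From HB Require Import structures.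
From Stdlib Require List.
From mathcomp Require Import all_boot all_algebra.

Set Implicit Arguments.
Unset Strict Implicit.
Unset Printing Implicit Defensive.

Import GRing.Theory.
Local Open Scope ring_scope.

Reserved Notation "x ** y" (at level 40, left associativity).

(* Finite-dimensional unital Z/2Z-graded associative algebras. The zero algebra
   must be allowed, which rules out [algType], and the library has no structure
   of possibly trivial algebra; so the product is part of this structure.
   Degrees are booleans: [hpart false] is the even part, [hpart true] the odd
   part, and degrees are added with [addb]. *)
HB.mixin Record isSuperAlgebra (K : fieldType) A of Vector K A := {
  smul : A -> A -> A;
  sone : A;
  smulA : associative smul;
  smul1l : left_id sone smul;
  smul1r : right_id sone smul;
  smulDl : left_distributive smul +%R;
  smulDr : right_distributive smul +%R;
  sscalerAl : forall (a : K) x y, a *: smul x y = smul (a *: x) y;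
  sscalerAr : forall (a : K) x y, a *: smul x y = smul x (a *: y);
  hpart : bool -> {vspace A};
  hpart_sum : (hpart false + hpart true = fullv)%VS;
  hpart_cap : (hpart false :&: hpart true = 0)%VS;
  hpartM : forall i j x y,
    x \in hpart i -> y \in hpart j -> smul x y \in hpart (i (+) j)
}.

#[short(type="superAlgType")]
HB.structure Definition SuperAlgebra (K : fieldType) :=
  { A of Vector K A & isSuperAlgebra K A }.

Notation "x ** y" := (smul x y) : ring_scope.

Section SuperAlgebras.

Variable K : fieldType.
Implicit Types A B : superAlgType K.

(* The projection of A onto its part of degree i along the other one. *)
Definition hproj A (i : bool) : 'End(A) :=
  daddv_pi (hpart i : {vspace A}) (hpart (~~ i)).

Definition lftrace (V : vectType K) (T : 'End(V)) : K :=
  \tr (passmx.mxof (vbasis {:V}) (vbasis {:V}) T).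

(* The trace of the V_i -> V_i component of T is computed on the whole space,
   where that component is extended by zero. *)
Definition str A (T : 'End(A)) : K :=
  lftrace (hproj A false \o T \o hproj A false)%VF
  - lftrace (hproj A true \o T \o hproj A true)%VF.

Definition supercommutative A : Prop :=
  forall i j (x y : A), x \in hpart i -> y \in hpart j ->
    x ** y = (-1) ^+ (i && j) *: (y ** x).

Definition unital_morph A B (f : A -> B) : Prop :=
  f sone = sone /\ (forall x y, f (x ** y) = f x ** f y).

Definition graded_map A B (f : A -> B) : Prop :=
  forall i x, x \in hpart i -> f x \in hpart i.

Definition graded_ideal A (I : {vspace A}) : Prop :=
  (I = (I :&: hpart false) + (I :&: hpart true))%VS
  /\ (forall a x, x \in I -> a ** x \in I /\ x ** a \in I).

Definition simple_superalg A : Prop :=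
  (sone : A) <> 0 /\
  (forall I : {vspace A}, graded_ideal I -> I = 0%VS \/ I = fullv).

Definition superalg_iso A B : Prop :=
  exists f : {linear A -> B},
    [/\ bijective f, unital_morph f & graded_map f].

End SuperAlgebras.

(* A grading given by its two projections. *)
Lemma proj_grading (K : fieldType) (V : vectType K)
    (p : bool -> {linear V -> V}) :
  (forall x, p false x + p true x = x) ->
  (forall i x, p i (p (~~ i) x) = 0) ->
  (lker (linfun (p true)) + lker (linfun (p false)) = fullv)%VS /\
  (lker (linfun (p true)) :&: lker (linfun (p false)) = 0)%VS.
Proof.
move=> pD pp; split; apply/vspaceP=> x; last first.
  rewrite memv_cap !memv_ker !lfunE /= memv0.
  apply/andP/eqP => [[/eqP xt /eqP xf]|->]; last by rewrite !linear0.
  by rewrite -(pD x) xt xf addr0.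
rewrite memvf -(pD x) memv_add // memv_ker lfunE /=.
  by rewrite (pp true).
by rewrite (pp false).
Qed.

Section BaseField.

Variable K : fieldType.

(* K is purely even. *)
Definition base_part (i : bool) : {vspace K^o} := if i then 0%VS else fullv.

Lemma base_sum : (base_part false + base_part true = fullv)%VS.
Proof. exact: addv0. Qed.

Lemma base_cap : (base_part false :&: base_part true = 0)%VS.
Proof. exact: capv0. Qed.

Lemma base_partM i j (x y : K^o) :
  x \in base_part i -> y \in base_part j -> x * y \in base_part (i (+) j).
Proof.
by case: i j => [] [] /=; rewrite ?memvf ?memv0 //;
  move=> /eqP-> // _ || move=> _ /eqP->; rewrite ?mul0r ?mulr0.
Qed.

HB.instance Definition _ := isSuperAlgebra.Build K K^o
  (@mulrA K) (@mul1r K) (@mulr1 K) (@mulrDl K) (@mulrDr K)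
  (@mulrA K) (@mulrCA K) base_sum base_cap base_partM.

End BaseField.

Section SuperMatrices.

Variables (K : fieldType) (n m : nat).

(* Mat(n|m): matrices of size n + m, with the diagonal blocks even and the
   off-diagonal blocks odd. *)
Definition smat : Type := 'M[K]_(n + m).

HB.instance Definition _ := Vector.copy smat 'M[K]_(n + m).

Definition smat_proj (i : bool) (X : smat) : smat :=
  if i then block_mx 0 (ursubmx X) (dlsubmx X) 0
  else block_mx (ulsubmx X) 0 0 (drsubmx X).

Fact smat_proj_linear i : linear (smat_proj i).
Proof.
suff: linear (smat_proj i : 'M_(n + m) -> 'M_(n + m)) by [].
move=> a X Y; rewrite /smat_proj; case: i;
  rewrite scale_block_mx add_block_mx !scaler0 !addr0;
  by congr block_mx; apply/matrixP=> r c; rewrite !mxE.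
Qed.
HB.instance Definition _ i :=
  GRing.isLinear.Build K smat smat _ (smat_proj i) (smat_proj_linear i).

Definition smat_part (i : bool) : {vspace smat} :=
  lker (linfun (smat_proj (~~ i))).

Lemma smat_projD X : smat_proj false X + smat_proj true X = X.
Proof. by rewrite add_block_mx !addr0 !add0r submxK. Qed.

Lemma smat_projN i X : smat_proj i (smat_proj (~~ i) X) = 0.
Proof.
by case: i; rewrite /smat_proj /= ?block_mxKul ?block_mxKur ?block_mxKdl
  ?block_mxKdr block_mx0.
Qed.

Lemma smat_sum : (smat_part false + smat_part true = fullv)%VS.
Proof.
by have [] := proj_grading (p := fun i => smat_proj i) smat_projD smat_projN.
Qed.

Lemma smat_cap : (smat_part false :&: smat_part true = 0)%VS.
Proof.
by have [] := proj_grading (p := fun i => smat_proj i) smat_projD smat_projN.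
Qed.

Lemma smat_partP i X : reflect (smat_proj i X = X) (X \in smat_part i).
Proof.
rewrite memv_ker lfunE /=; apply: (iffP eqP) => [X0|<-].
  by rewrite -{2}(smat_projD X); case: i X0 => /= ->; rewrite ?add0r ?addr0.
by rewrite -{2}[i]negbK smat_projN.
Qed.

Lemma smat_partM i j (X Y : smat) :
  X \in smat_part i -> Y \in smat_part j -> X *m Y \in smat_part (i (+) j).
Proof.
move=> /smat_partP <- /smat_partP <-; apply/smat_partP.
rewrite /smat_proj.
case: i j => [] [] /=; rewrite mulmx_block !mulmx0 !mul0mx ?addr0 ?add0r;
  by rewrite !(block_mxKul, block_mxKur, block_mxKdl, block_mxKdr).
Qed.

HB.instance Definition _ := isSuperAlgebra.Build K smat
  (@mulmxA K _ _ _ _) (@mul1mx K _ _) (@mulmx1 K _ _)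
  (@mulmxDl K _ _ _) (@mulmxDr K _ _ _)
  (@scalemxAl K _ _ _) (@scalemxAr K _ _ _)
  smat_sum smat_cap smat_partM.

Definition mxstr (X : smat) : K := \tr (ulsubmx X) - \tr (drsubmx X).

Fact mxstr_scalar : scalar mxstr.
Proof.
suff: scalar (mxstr : 'M_(n + m) -> K) by [].
move=> a X Y; rewrite /mxstr.
have ->: ulsubmx (a *: X + Y) = a *: ulsubmx X + ulsubmx Y.
  by apply/matrixP=> r c; rewrite !mxE.
have ->: drsubmx (a *: X + Y) = a *: drsubmx X + drsubmx Y.
  by apply/matrixP=> r c; rewrite !mxE.
by rewrite !linearP /= mulrBr opprD addrACA.
Qed.
HB.instance Definition _ := GRing.isLinear.Build K smat K _ mxstr mxstr_scalar.

End SuperMatrices.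

Section QAlgebra.

Variables (K : fieldType) (n : nat).

(* Q(n) = Mat(n)[xi]: the pair (X, Y) stands for X + Y xi. *)
Definition qmat : Type := ('M[K]_n * 'M[K]_n)%type.

HB.instance Definition _ := Vector.copy qmat ('M[K]_n * 'M[K]_n)%type.

Definition qmul (x y : qmat) : qmat :=
  (x.1 *m y.1 + x.2 *m y.2, x.1 *m y.2 + x.2 *m y.1).
Definition qone : qmat := (1%:M, 0).

Fact qmulA : associative qmul.
Proof.
move=> [a b] [c d] [e f]; rewrite /qmul /=; congr pair;
  by rewrite !mulmxDl !mulmxDr !mulmxA [X in _ + X = _]addrC addrACA.
Qed.
Fact qmul1l : left_id qone qmul.
Proof. by case=> a b; rewrite /qmul /= !mul1mx !mul0mx !addr0. Qed.
Fact qmul1r : right_id qone qmul.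
Proof. by case=> a b; rewrite /qmul /= !mulmx1 !mulmx0 addr0 add0r. Qed.
Fact qmulDl : left_distributive qmul +%R.
Proof.
by move=> [a b] [c d] [e f]; rewrite /qmul /=; congr pair;
  rewrite /= !mulmxDl addrACA.
Qed.
Fact qmulDr : right_distributive qmul +%R.
Proof.
by move=> [a b] [c d] [e f]; rewrite /qmul /=; congr pair;
  rewrite /= !mulmxDr addrACA.
Qed.

Definition qmat_proj (i : bool) (x : qmat) : qmat :=
  if i then (0, x.2) else (x.1, 0).

Fact qmat_proj_linear i : linear (qmat_proj i).
Proof.
by move=> a x y; case: i; congr pair; rewrite /= ?scaler0 ?addr0.
Qed.
HB.instance Definition _ i :=
  GRing.isLinear.Build K qmat qmat _ (qmat_proj i) (qmat_proj_linear i).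

Definition qmat_part (i : bool) : {vspace qmat} :=
  lker (linfun (qmat_proj (~~ i))).

Lemma qmat_projD x : qmat_proj false x + qmat_proj true x = x.
Proof. by case: x => a b; congr pair; rewrite /= ?addr0 ?add0r. Qed.

Lemma qmat_projN i x : qmat_proj i (qmat_proj (~~ i) x) = 0.
Proof. by case: i. Qed.

Lemma qmat_sum : (qmat_part false + qmat_part true = fullv)%VS.
Proof.
by have [] := proj_grading (p := fun i => qmat_proj i) qmat_projD qmat_projN.
Qed.

Lemma qmat_cap : (qmat_part false :&: qmat_part true = 0)%VS.
Proof.
by have [] := proj_grading (p := fun i => qmat_proj i) qmat_projD qmat_projN.
Qed.

Lemma qmat_partP i x : reflect (qmat_proj i x = x) (x \in qmat_part i).
Proof.
rewrite memv_ker lfunE /=; apply: (iffP eqP) => [x0|<-].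
  by rewrite -{2}(qmat_projD x); case: i x0 => /= ->; rewrite ?add0r ?addr0.
by rewrite -{2}[i]negbK qmat_projN.
Qed.

Lemma qmat_partM i j (x y : qmat) :
  x \in qmat_part i -> y \in qmat_part j -> qmul x y \in qmat_part (i (+) j).
Proof.
move=> /qmat_partP <- /qmat_partP <-; apply/qmat_partP.
by case: i j => [] [] /=; congr pair;
  rewrite /= ?mulmx0 ?mul0mx ?addr0 ?add0r.
Qed.

Fact qscalerAl (a : K) (x y : qmat) : a *: qmul x y = qmul (a *: x) y.
Proof. by congr pair; rewrite /= scalerDr !scalemxAl. Qed.
Fact qscalerAr (a : K) (x y : qmat) : a *: qmul x y = qmul x (a *: y).
Proof. by congr pair; rewrite /= scalerDr !scalemxAr. Qed.

HB.instance Definition _ := isSuperAlgebra.Build K qmat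
  qmulA qmul1l qmul1r qmulDl qmulDr qscalerAl qscalerAr
  qmat_sum qmat_cap qmat_partM.

(* X + Y xi |-> tr Y *)
Definition qtr (x : qmat) : K := \tr x.2.

Fact qtr_scalar : scalar qtr.
Proof. by move=> a x y; rewrite /qtr linearP. Qed.
HB.instance Definition _ := GRing.isLinear.Build K qmat K _ qtr qtr_scalar.

End QAlgebra.

Section Product.

Variables (K : fieldType) (A B : superAlgType K).

Definition prod_part (i : bool) : {vspace A * B} :=
  ((linfun fst @^-1: hpart i) :&: (linfun snd @^-1: hpart i))%VS.

Lemma prod_partE i x :
  (x \in prod_part i) = (x.1 \in hpart i) && (x.2 \in hpart i).
Proof. by rewrite memv_cap -!memv_preim !lfunE. Qed.

Lemma prod_sum : (prod_part false + prod_part true = fullv)%VS.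
Proof.
apply/vspaceP=> -[a b]; rewrite memvf.
have: a \in fullv by rewrite memvf.
rewrite -hpart_sum => /memv_addP[a0 a0P [a1 a1P ->]].
have: b \in fullv by rewrite memvf.
rewrite -hpart_sum => /memv_addP[b0 b0P [b1 b1P ->]].
by rewrite -[(_, _)]/((a0, b0) + (a1, b1)) memv_add // prod_partE /=
  ?a0P ?a1P.
Qed.

Lemma prod_cap : (prod_part false :&: prod_part true = 0)%VS.
Proof.
apply/vspaceP=> -[a b]; rewrite memv_cap !prod_partE /= memv0.
apply/idP/eqP => [|[-> ->]]; last by rewrite !mem0v.
move=> /andP[/andP[a0 b0] /andP[a1 b1]].
have: a \in (hpart false :&: hpart true)%VS by rewrite memv_cap a0.
have: b \in (hpart false :&: hpart true)%VS by rewrite memv_cap b0.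
by rewrite !hpart_cap !memv0 => /eqP-> /eqP->.
Qed.

Definition pmul (x y : A * B) : A * B := (x.1 ** y.1, x.2 ** y.2).
Definition pone : A * B := (sone, sone).

Fact pmulA : associative pmul.
Proof. by move=> x y z; rewrite /pmul /= !smulA. Qed.
Fact pmul1l : left_id pone pmul.
Proof. by case=> x y; rewrite /pmul /= !smul1l. Qed.
Fact pmul1r : right_id pone pmul.
Proof. by case=> x y; rewrite /pmul /= !smul1r. Qed.
Fact pmulDl : left_distributive pmul +%R.
Proof. by move=> x y z; rewrite /pmul /= !smulDl. Qed.
Fact pmulDr : right_distributive pmul +%R.
Proof. by move=> x y z; rewrite /pmul /= !smulDr. Qed.
Fact pscalerAl (a : K) (x y : A * B) : a *: pmul x y = pmul (a *: x) y.
Proof. by congr pair; exact: sscalerAl. Qed.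
Fact pscalerAr (a : K) (x y : A * B) : a *: pmul x y = pmul x (a *: y).
Proof. by congr pair; exact: sscalerAr. Qed.

Lemma prod_partM i j (x y : A * B) :
  x \in prod_part i -> y \in prod_part j -> pmul x y \in prod_part (i (+) j).
Proof.
by rewrite !prod_partE => /andP[x1 x2] /andP[y1 y2]; rewrite !hpartM.
Qed.

HB.instance Definition _ := isSuperAlgebra.Build K (A * B)%type
  pmulA pmul1l pmul1r pmulDl pmulDr pscalerAl pscalerAr
  prod_sum prod_cap prod_partM.

End Product.

Section CardyFrobenius.

Variable K : fieldType.

(* The zero algebra, as Mat(0|0). *)
Definition superalg0 : superAlgType K := smat K 0 0.

Definition superalg_dsum (s : seq (superAlgType K)) : superAlgType K :=
  foldr (fun A B : superAlgType K => (A * B)%type : superAlgType K)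
    superalg0 s.

(* Semisimple: isomorphic to a (possibly empty) finite direct sum of simple
   superalgebras. *)
Definition semisimple_superalg (A : superAlgType K) : Prop :=
  exists2 s : seq (superAlgType K),
    List.Forall (@simple_superalg K) s
    & superalg_iso A (superalg_dsum s).

(* The data (A, B, theta_A, theta_B, tau^*, tau_* ); [tau_up] is
   tau^* : B -> A and [tau_dn] is tau_* : A -> B. *)
Record cf_data := CFData {
  bulk : superAlgType K;
  bdry : superAlgType K;
  theta_bulk : {scalar bulk};
  theta_bdry : {scalar bdry};
  tau_up : {linear bdry -> bulk};
  tau_dn : {linear bulk -> bdry}
}.

Definition frobenius_form (A : superAlgType K) (theta : A -> K) : Prop :=
  (forall x, (forall y, theta (x ** y) = 0) -> x = 0)
  /\ (forall i j x y, x \in hpart i -> y \in hpart j ->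
        theta (x ** y) = (-1) ^+ (i && j) * theta (y ** x)).

(* f |-> (-1)^(|X||Y| + |X||f|) Y f X, extended linearly from homogeneous
   X, Y, f. *)
Definition cardy_fun (B : superAlgType K) (X Y f : B) : B :=
  \sum_(i : bool) \sum_(j : bool) \sum_(k : bool)
    (-1) ^+ ((i && j) + (i && k)) *:
      (hproj B j Y ** hproj B k f ** hproj B i X).

Record super_cardy_frobenius (C : cf_data) : Prop := SuperCardyFrobenius {
  scf_comm : supercommutative (bulk C);
  scf_bulk_form : frobenius_form (theta_bulk C);
  scf_bdry_form : frobenius_form (theta_bdry C);
  scf_dn_morph : unital_morph (tau_dn C);
  scf_dn_graded : graded_map (tau_dn C);
  scf_dn_central : forall a b, tau_dn C a ** b = b ** tau_dn C a;
  scf_adjoint : forall a b,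
    theta_bdry C (tau_dn C a ** b) = theta_bulk C (a ** tau_up C b);
  scf_up_parity : exists p : bool,
    forall i b, b \in hpart i -> tau_up C b \in hpart (i (+) p);
  scf_cardy : forall X Y,
    theta_bulk C (tau_up C X ** tau_up C Y) = str (linfun (cardy_fun X Y))
}.

Definition cf_semisimple (C : cf_data) : Prop :=
  semisimple_superalg (bulk C) /\ semisimple_superalg (bdry C).

Definition cf_iso (C D : cf_data) : Prop :=
  exists (f : {linear bulk C -> bulk D}) (g : {linear bdry C -> bdry D}),
    [/\ [/\ bijective f, unital_morph f & graded_map f],
        [/\ bijective g, unital_morph g & graded_map g],
        (forall a, theta_bulk D (f a) = theta_bulk C a)
          /\ (forall b, theta_bdry D (g b) = theta_bdry C b),
        forall b, tau_up D (g b) = f (tau_up C b)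
      & forall a, tau_dn D (f a) = g (tau_dn C a)].

Section DirectSum.

Variables C D : cf_data.

Definition sum_theta_bulk (x : bulk C * bulk D) : K :=
  theta_bulk C x.1 + theta_bulk D x.2.
Definition sum_theta_bdry (x : bdry C * bdry D) : K :=
  theta_bdry C x.1 + theta_bdry D x.2.
Definition sum_tau_up (x : bdry C * bdry D) : bulk C * bulk D :=
  (tau_up C x.1, tau_up D x.2).
Definition sum_tau_dn (x : bulk C * bulk D) : bdry C * bdry D :=
  (tau_dn C x.1, tau_dn D x.2).

Fact sum_theta_bulk_scalar : scalar sum_theta_bulk.
Proof.
by move=> a x y; rewrite /sum_theta_bulk !linearP /= mulrDr addrACA.
Qed.
HB.instance Definition _ :=
  GRing.isLinear.Build K (bulk C * bulk D)%type K _ sum_theta_bulk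
    sum_theta_bulk_scalar.

Fact sum_theta_bdry_scalar : scalar sum_theta_bdry.
Proof.
by move=> a x y; rewrite /sum_theta_bdry !linearP /= mulrDr addrACA.
Qed.
HB.instance Definition _ :=
  GRing.isLinear.Build K (bdry C * bdry D)%type K _ sum_theta_bdry
    sum_theta_bdry_scalar.

Fact sum_tau_up_linear : linear sum_tau_up.
Proof. by move=> a x y; rewrite /sum_tau_up !linearP. Qed.
HB.instance Definition _ :=
  GRing.isLinear.Build K (bdry C * bdry D)%type (bulk C * bulk D)%type _
    sum_tau_up sum_tau_up_linear.

Fact sum_tau_dn_linear : linear sum_tau_dn.
Proof. by move=> a x y; rewrite /sum_tau_dn !linearP. Qed.
HB.instance Definition _ :=
  GRing.isLinear.Build K (bulk C * bulk D)%type (bdry C * bdry D)%type _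
    sum_tau_dn sum_tau_dn_linear.

Definition cf_sum : cf_data :=
  @CFData (bulk C * bulk D)%type (bdry C * bdry D)%type
    sum_theta_bulk sum_theta_bdry sum_tau_up sum_tau_dn.

End DirectSum.

Definition cf_zero : cf_data :=
  @CFData superalg0 superalg0 \0 \0 \0 \0.

Definition cf_dsum (s : seq cf_data) : cf_data := foldr cf_sum cf_zero s.

Definition scale_form (V : lmodType K) (a : K) (f : V -> K) (x : V) : K :=
  a * f x.

Fact scale_form_scalar (V : lmodType K) a (f : {scalar V}) :
  scalar (scale_form a f).
Proof.
by move=> b x y; rewrite /scale_form linearP mulrDr mulrCA.
Qed.
HB.instance Definition _ (V : lmodType K) a (f : {scalar V}) :=
  GRing.isLinear.Build K V K _ (scale_form a f) (scale_form_scalar a f).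

(* The same map, with values in the algebra K. *)
Definition scale_base (V : lmodType K) (a : K) (f : V -> K) (x : V) : K^o :=
  a * f x.

Fact scale_base_linear (V : lmodType K) a (f : {scalar V}) :
  linear (scale_base a f).
Proof. exact: scale_form_scalar. Qed.
HB.instance Definition _ (V : lmodType K) a (f : {scalar V}) :=
  GRing.isLinear.Build K V K^o _ (scale_base a f) (scale_base_linear a f).

Definition base_form (a : K) (x : K^o) : K := a * x.

Fact base_form_scalar a : scalar (base_form a).
Proof. by move=> b x y; rewrite /base_form mulrDr mulrCA. Qed.
HB.instance Definition _ a :=
  GRing.isLinear.Build K K^o K _ (base_form a) (base_form_scalar a).

Definition smat_unit n m (x : K^o) : smat K n m := x%:M.

Fact smat_unit_linear n m : linear (@smat_unit n m).
Proof.
by move=> a x y; rewrite /smat_unit raddfD /= -scale_scalar_mx.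
Qed.
HB.instance Definition _ n m :=
  GRing.isLinear.Build K K^o (smat K n m) _ (@smat_unit n m)
    (@smat_unit_linear n m).

Definition qmat_unit n (x : K^o) : qmat K n := (x%:M, 0).

Fact qmat_unit_linear n : linear (@qmat_unit n).
Proof.
move=> a x y; congr pair; last by rewrite /= scaler0 addr0.
by rewrite /= raddfD /= -scale_scalar_mx.
Qed.
HB.instance Definition _ n :=
  GRing.isLinear.Build K K^o (qmat K n) _ (@qmat_unit n)
    (@qmat_unit_linear n).

Definition cf_E1 (lambda : K) : cf_data :=
  @CFData K^o superalg0 (base_form lambda) \0 \0 \0.

Definition cf_E2 (n m : nat) (lambda mu : K) : cf_data :=
  @CFData K^o (smat K n m) (base_form lambda)
    (scale_form mu (@mxstr K n m))
    (scale_base (mu / lambda) (@mxstr K n m))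
    (@smat_unit n m).

Definition cf_E3 (n : nat) (lambda mu : K) : cf_data :=
  @CFData K^o (qmat K n) (base_form lambda)
    (scale_form mu (@qtr K n))
    (scale_base (mu / lambda) (@qtr K n))
    (@qmat_unit n).

(* The sign in [Elementary3]: on Q(n), str m_{X,Y} = - 2 tr(X_1) tr(Y_1), where
   X_1, Y_1 are the coefficients of xi. For instance, on Q(1), m_{xi,xi} maps 1
   to -1 and xi to xi, so that its supertrace is -2, while
   theta_A(tau^*(xi) tau^*(xi)) = mu^2 / lambda. With the sign conventions of
   [cardy_fun] and xi^2 = 1, the Cardy condition thus amounts to
   lambda = - mu^2 / 2, instead of lambda = mu^2 / 2 as sometimes printed. *)
Inductive elementary_cf : cf_data -> Prop :=
| Elementary1 lambda :
    lambda != 0 -> elementary_cf (cf_E1 lambda)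
| Elementary2 n m lambda mu :
    lambda != 0 -> mu != 0 -> lambda = mu ^+ 2 ->
    elementary_cf (cf_E2 n m lambda mu)
| Elementary3 n lambda mu :
    lambda != 0 -> mu != 0 -> lambda = - (mu ^+ 2 / 2%:R) ->
    elementary_cf (cf_E3 n lambda mu).

End CardyFrobenius.

(* Main.v *)
Require Import Defs.
From HB Require Import structures.
From Stdlib Require List.
From Stdlib Require Import Classical.
From mathcomp Require Import all_boot all_algebra.

(* The bulk algebra is K^r with orthogonal idempotents e_i, and c_i = tau_* e_i
   cuts the boundary algebra into corners c_i B on which theta_A (e_i) = lambda
   turns the Cardy condition into theta(X) theta(Y) / lambda = str m_{X,Y}.
   Together with nondegeneracy this makes c_i B graded prime, so (if nonzero) a
   minimal graded left ideal is generated by an even idempotent e with e B e a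
   graded division algebra, i.e. K e or K e + K xi with xi^2 = e. Dual bases
   u_k of B e (resp. of its even part) and v_k of e B yield the matrix units
   u_k v_l (resp. also u_k xi v_l), so that c_i B is Mat(n|m) (resp. Q(n)).
   Finally the Cardy condition at X = Y = e (resp. X = Y = xi), where the
   supertrace is 1 (resp. -2), relates lambda to mu = theta e (resp. theta xi). *)

Set Implicit Arguments.
Unset Strict Implicit.
Unset Printing Implicit Defensive.

Import GRing.Theory.
Local Open Scope ring_scope.

(** A corner c B has unit c, not [sone], so it is no object of [superAlgType]. Arguments therefore
    run in the ambient B on elements fixed by c, and the elementary algebras are mapped into C.
    Embeddings with orthogonal units can be added, which builds the direct sum; the total map is
    inverted at the end.

    Dual bases exist because of primeness. With kappa b the coefficient of e in e b e, the pairing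
    kappa (y x) separates the elements x of B e, since e B x = 0 forces x = 0. Likewise the sum of
    the u_k v_k is c because both act as the identity on B e.

    The recurrent obstacle is the grading: primeness and inversion are available for homogeneous
    elements only, so each chosen element is first replaced by a homogeneous component, and e has to
    be kept even.

    That 2 is nonzero matters for odd elements: it makes them square to zero in a supercommutative
    algebra, it forces theta e = theta (xi xi) = 0 in the case of Q(n), and it makes the supertrace
    -2 nonzero, so that mu is nonzero. *)

Section VectorSpaces.

Variables (K : fieldType) (V : vectType K).

Lemma lftrace_rank1 (T : 'End(V)) (phi : {scalar V}) (w : V) :
  (forall x, T x = phi x *: w) -> lftrace T = phi w.
Proof.
move=> Tw; rewrite /lftrace /mxtrace.
rewrite [in RHS](coord_vbasis (memvf w)) linear_sum; apply: eq_bigr => i _.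
rewrite mxE /= mxE passmx.vecof_delta Tw.
by rewrite !linearZ /= mulrC.
Qed.

(* Coefficient along [w]; arbitrary outside the line [<[w]>]. *)
Definition coef (w : V) : V -> K := coord [tuple w] ord0.
HB.instance Definition _ w := GRing.Linear.copy (coef w) (coord [tuple w] ord0).

Lemma coefK w x : x \in <[w]>%VS -> coef w x *: w = x.
Proof.
move=> xw; rewrite [in RHS](@coord_span _ _ _ [tuple w] x) ?big_ord1 //.
by rewrite span_seq1.
Qed.

Lemma coef_id w : w != 0 -> coef w w = 1.
Proof. by move=> w0; have := @coord_free _ _ _ [tuple w] ord0 ord0;
  rewrite seq1_free => /(_ w0). Qed.

End VectorSpaces.

(** T restricts to an endomorphism of [subvs_of U], whose characteristic polynomial has degree dim U
    > 0 and hence a root. *)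
Lemma eigenvector_exists (K : closedFieldType) (V : vectType K) (U : {vspace V})
    (T : 'End(V)) :
  U != 0%VS -> (forall x, x \in U -> T x \in U) ->
  exists a x, [/\ x \in U, x != 0 & T x = a *: x].
Proof.
move=> U0 TU.
pose T' : 'End(subvs_of U) := linfun (vsproj U \o T \o vsval).
pose A := passmx.mxof (vbasis {:subvs_of U}) (vbasis {:subvs_of U}) T'.
have /closed_rootP[a] : size (char_poly A) != 1%N.
  rewrite size_char_poly eqSS dimvf; apply: contra U0 => /eqP.
  by rewrite /dim /= => d0; rewrite -dimv_eq0; apply/eqP.
rewrite -eigenvalue_root_char => /eigenvalueP[v vA v0].
pose x := passmx.vecof (vbasis {:subvs_of U}) v.
have bas := vbasisP {:subvs_of U}.
have Tx : T' x = a *: x.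
  rewrite (passmx.hom_vecof (vbasis _) bas) -/A vA /x /passmx.vecof scaler_sumr.
  by apply: eq_bigr => i _; rewrite mxE scalerA.
exists a, (vsval x); split; first exact: subvsP.
  apply: contra v0 => /eqP x0; rewrite -(passmx.vecof_eq0 bas); apply/eqP.
  by apply: subvs_inj; rewrite x0 linear0.
move/(congr1 vsval): Tx; rewrite lfunE /= vsprojK ?TU ?subvsP //.
Qed.

(** * Bilinearity of the product and homogeneous components *)

Section SuperAlgebra.

Variables (K : fieldType) (B : superAlgType K).
Implicit Types (x y z : B) (i j : bool).

Fact smul_linear x : linear (smul x : B -> B).
Proof. by move=> a y z; rewrite smulDr sscalerAr. Qed.
HB.instance Definition _ x := GRing.isLinear.Build K B B _ (smul x)
  (smul_linear x).

Definition smulr y x := x ** y.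
Fact smulr_linear y : linear (smulr y).
Proof. by move=> a x z; rewrite /smulr smulDl sscalerAl. Qed.
HB.instance Definition _ y := GRing.isLinear.Build K B B _ (smulr y)
  (smulr_linear y).

Lemma smul0 x : 0 ** x = 0. Proof. exact: (linear0 (smulr x)). Qed.
Lemma smulr0 x : x ** 0 = 0. Proof. exact: (linear0 (smul x)). Qed.
Lemma smulBl x y z : (x - y) ** z = x ** z - y ** z.
Proof. exact: (linearB (smulr z)). Qed.
Lemma smulBr x y z : z ** (x - y) = z ** x - z ** y.
Proof. exact: (linearB (smul z)). Qed.
Lemma smul_suml (I : Type) (r : seq I) (P : pred I) (F : I -> B) x :
  (\sum_(k <- r | P k) F k) ** x = \sum_(k <- r | P k) F k ** x.
Proof. exact: (linear_sum (smulr x)). Qed.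
Lemma smul_sumr (I : Type) (r : seq I) (P : pred I) (F : I -> B) x :
  x ** (\sum_(k <- r | P k) F k) = \sum_(k <- r | P k) x ** F k.
Proof. exact: (linear_sum (smul x)). Qed.

Lemma hpart_capC i : (hpart i :&: hpart (~~ i) = 0 :> {vspace B})%VS.
Proof. by case: i; rewrite ?(capvC (hpart true)) hpart_cap. Qed.

Lemma hprojP i x : hproj B i x \in hpart i.
Proof. exact: memv_pi. Qed.

Lemma hproj_sum x : hproj B false x + hproj B true x = x.
Proof. by rewrite /hproj daddv_pi_add ?hpart_cap ?hpart_sum ?memvf. Qed.

Lemma hproj_sumi i x : hproj B i x + hproj B (~~ i) x = x.
Proof. by case: i => /=; [rewrite addrC|]; exact: hproj_sum. Qed.

Lemma hproj_id i x : x \in hpart i -> hproj B i x = x.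
Proof. by move=> xi; rewrite /hproj daddv_pi_id // hpart_capC. Qed.

Lemma hproj0 i x : x \in hpart i -> hproj B (~~ i) x = 0.
Proof.
by move=> xi; apply: (addrI (hproj B i x)); rewrite hproj_sumi hproj_id ?addr0.
Qed.

Lemma hprojE i j x : x \in hpart i -> hproj B j x = if i == j then x else 0.
Proof.
by move=> xi; case: i j xi => [] [] xi; (exact: hproj_id xi || exact:
  hproj0 xi).
Qed.

Lemma hprojMl i j x y :
  x \in hpart i -> hproj B j (x ** y) = x ** hproj B (i (+) j) y.
Proof.
move=> xi; rewrite -[in LHS](hproj_sumi (i (+) j) y) smulDr linearD /=.
have := hpartM _ _ _ _ xi (hprojP (i (+) j) y); rewrite addKb => /hproj_id ->.
have := hpartM _ _ _ _ xi (hprojP (~~ (i (+) j)) y).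
by rewrite addbN addKb => /hproj0; rewrite negbK => ->; rewrite addr0.
Qed.

Lemma hprojMr i j x y :
  x \in hpart i -> hproj B j (y ** x) = hproj B (j (+) i) y ** x.
Proof.
move=> xi; rewrite -[in LHS](hproj_sumi (j (+) i) y) smulDl linearD /=.
have := hpartM _ _ _ _ (hprojP (j (+) i) y) xi; rewrite addbK => /hproj_id ->.
have := hpartM _ _ _ _ (hprojP (~~ (j (+) i)) y) xi.
by rewrite addNb addbK => /hproj0; rewrite negbK => ->; rewrite addr0.
Qed.

(** By hypothesis the matrix P that pairs a basis of B with the u_l has independent columns; the
    rows of a left inverse of P are the coordinates of the y_k. *)
Lemma dual_family (kappa : {scalar B}) r (u : 'I_r -> B) :
  (forall a : 'I_r -> K, (forall y, kappa (y ** (\sum_k a k *: u k)) = 0) ->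
     forall k, a k = 0) ->
  exists y : 'I_r -> B, forall k l, kappa (y k ** u l) = (k == l)%:R.
Proof.
move=> sep; pose P := \matrix_(k < \dim {:B}, l < r) kappa ((vbasis {:B})`_k **
  u l).
have fullP : row_full P.
  rewrite /row_full -mxrank_tr -/(row_free P^T) -kermx_eq0.
  apply/eqP/row_matrixP => k; rewrite row0.
  set a := row k _; have aP : a *m P^T = 0 by apply/sub_kermxP; apply: row_sub.
  apply/rowP => i; rewrite [RHS]mxE; apply: (sep (fun l => a 0 l)) => y.
  rewrite (coord_vbasis (memvf y)) smul_suml linear_sum big1 //= => l _.
  rewrite -sscalerAl linearZ smul_sumr linear_sum /=.
  apply: etrans (mulr0 _); congr (_ * _).
  move/rowP/(_ l): aP; rewrite [RHS]mxE mxE => aPl; rewrite -[RHS]aPl.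
  apply: eq_bigr => j _.
  by rewrite -sscalerAr linearZ !mxE.
exists (fun l => \sum_k (pinvmx P) l k *: (vbasis {:B})`_k) => k l.
rewrite smul_suml linear_sum.
have := congr1 (fun M : 'M_r => M k l) (mulVpmx fullP).
rewrite !mxE => <-; apply: eq_bigr => j _.
by rewrite !mxE -sscalerAl linearZ.
Qed.

End SuperAlgebra.

(** * Graded left ideals of prime superalgebras *)

Section LeftIdeals.

Variables (K : fieldType) (B : superAlgType K).

Definition graded_left_ideal (L : {vspace B}) : Prop :=
  (forall i x, x \in L -> hproj B i x \in L)
  /\ (forall a x, x \in L -> a ** x \in L).

Lemma minimal_left_ideal (L0 : {vspace B}) :
  graded_left_ideal L0 -> L0 != 0%VS ->
  exists M : {vspace B}, [/\ graded_left_ideal M, M != 0%VS, (M <= L0)%VS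
    & forall L, graded_left_ideal L -> (L <= M)%VS -> L != 0%VS -> L = M].
Proof.
have [n] := ubnP (\dim L0); elim: n L0 => // n IH L0 ltn L0i L0n0.
case: (classic (exists L, [/\ graded_left_ideal L, (L <= L0)%VS,
  L != 0%VS & L != L0])).
  case=> L [Li LL0 Ln0 neq].
  have ltd : (\dim L < n)%N.
    rewrite -ltnS; apply: leq_trans ltn; rewrite ltnS ltn_neqAle dimvS // andbT.
    by rewrite (dimv_leqif_eq LL0).
  have [M [? ? ML ?]] := IH L ltd Li Ln0.
  by exists M; split=> //; apply: subv_trans LL0.
move=> min; exists L0; split=> // L Li LL0 Ln0; apply/eqP/negPn/negP => neq.
by apply: min; exists L.
Qed.

(** Right multiplication by y commutes with left multiplications and, y being homogeneous, only
    shifts degrees. This image and the kernel in the next lemma are the two halves of a graded Schur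
    lemma. *)
Lemma left_ideal_img (M : {vspace B}) i y :
  graded_left_ideal M -> y \in hpart i ->
  graded_left_ideal (linfun (smulr y) @: M)%VS.
Proof.
move=> [Mg Mi] yi; split=> [j x /memv_imgP[m mM ->]|a x /memv_imgP[m mM ->]].
  rewrite lfunE /= /smulr (hprojMr _ _ yi) -[_ ** y]/(smulr y _) -[smulr y
    _](lfunE (smulr y)).
  by rewrite memv_img ?Mg.
rewrite lfunE /= /smulr smulA -[_ ** y]/(smulr y _) -[smulr y _](lfunE (smulr
  y)).
by rewrite memv_img ?Mi.
Qed.

Lemma left_ideal_annihilator (M : {vspace B}) i y :
  graded_left_ideal M -> y \in hpart i ->
  graded_left_ideal (M :&: lker (linfun (smulr y)))%VS.
Proof.
move=> [Mg Mi] yi; split=> [j x|a x]; rewrite !memv_cap !memv_ker !lfunE /=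
  /smulr;
  case/andP=> xM /eqP x0.
  by rewrite Mg //= -[j](addbK i) -hprojMr // x0 linear0.
by rewrite Mi //= -smulA x0 smulr0.
Qed.

(** For a central idempotent c, the elementwise form of: two nonzero graded ideals of c B have a
    nonzero product. *)
Definition graded_prime (c : B) : Prop :=
  forall i j X Y, X \in hpart i -> Y \in hpart j -> c ** X = X -> c ** Y = Y ->
    (forall f, Y ** f ** X = 0) -> X = 0 \/ Y = 0.

Lemma nonzero_component (x : B) : x != 0 -> exists i, hproj B i x != 0.
Proof.
move=> x0; case: (eqVneq (hproj B false x) 0) => [h0|]; last by exists false.
by exists true; move: x0; rewrite -{1}(hproj_sum x) h0 add0r.
Qed.

Variable c : B.
Hypotheses (c_central : forall b, c ** b = b ** c) (c_even : c \in hpart false)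
  (c_idem : c ** c = c) (c_neq0 : c != 0) (c_prime : graded_prime c).

(* [e] generates a minimal graded left ideal, so e B e is a graded division
   algebra. *)
Lemma division_corner :
  exists e : B, [/\ e \in hpart false, e != 0, e ** e = e, c ** e = e
    & forall i y, y \in hpart i -> e ** y ** e = y -> y != 0 ->
        exists z, [/\ z \in hpart i, e ** z ** e = z & z ** y = e]].
Proof.
have cB_ideal : graded_left_ideal (limg (linfun (smul c))).
  split=> [j x /memv_imgP[m _ ->]|a x /memv_imgP[m _ ->]]; rewrite lfunE /=.
    by rewrite (hprojMl _ _ c_even) -[c ** _](lfunE (smul c)) memv_img ?memvf.
  by rewrite smulA -c_central -smulA -[c ** _](lfunE (smul c)) memv_img ?memvf.
have cB0 : limg (linfun (smul c)) != 0%VS.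
  apply: contra c_neq0 => /eqP c0; rewrite -memv0 -c0 -{1}c_idem.
  by rewrite -[c ** _](lfunE (smul c)) memv_img ?memvf.
have [M [Mid M0 McB minM]] := minimal_left_ideal cB_ideal cB0.
have cM x : x \in M -> c ** x = x.
  by move/(subvP McB)/memv_imgP=> [y _ ->]; rewrite lfunE /= smulA c_idem.
have [Mg Mi] := Mid.
have [i ri] : exists i, hproj B i (vpick M) != 0.
  by apply: nonzero_component; rewrite vpick0.
set r := hproj B i (vpick M) in ri.
have rM : r \in M by rewrite Mg ?memv_pick.
(* Primeness with X = Y = r. The middle factor is taken homogeneous, so that w below is a
   homogeneous element of M with r w nonzero. *)
have [k [f rfr]] : exists k f, r ** (hproj B k f ** r) != 0.
  apply: NNPP => no.
  suff [] : r = 0 \/ r = 0 by move/eqP; rewrite (negPf ri).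
  apply: (c_prime (hprojP i _) (hprojP i _)); rewrite ?cM // => f.
  rewrite -smulA -(hproj_sum f) smulDl smulDr.
  have z k : r ** (hproj B k f ** r) = 0.
    by apply/eqP/negPn/negP => nz; apply: no; exists k, f.
  by rewrite !z addr0.
set w := hproj B k f ** r in rfr; set j := k (+) i.
have wj : w \in hpart j by rewrite hpartM ?hprojP.
have wM : w \in M by rewrite Mi.
have in_img (m y : B) : m \in M -> m ** y \in (linfun (smulr y) @: M)%VS.
  by move=> mM; rewrite -[m ** y]/(smulr y m) -[smulr y m](lfunE (smulr y))
    memv_img.
have imgM (y : B) l : y \in hpart l -> y \in M ->
    (exists2 m, m \in M & m ** y != 0) -> (linfun (smulr y) @: M)%VS = M.
  move=> yl yM [m mM my]; apply: minM; first exact: left_ideal_img yl.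
    by apply/subvP=> x /memv_imgP[z zM ->]; rewrite lfunE /= Mi.
  by apply: contra my => /eqP i0; rewrite -memv0 -i0 in_img.
have [e' e'M e'w] : exists2 e', e' \in M & w = e' ** w.
  have: w \in (linfun (smulr w) @: M)%VS by rewrite (imgM w j) //; exists r.
  by case/memv_imgP=> m mM; rewrite lfunE /=; exists m.
(* The solution e' of e' w = w may be inhomogeneous; comparing components of degree j, its even part
   fixes w too. *)
set e := hproj B false e'.
have eM : e \in M by rewrite Mg.
have ew : e ** w = w.
  by have := hprojMr j e' wj; rewrite -e'w addbb hproj_id.
(* The z in M with z w = 0 form a graded left ideal that misses r, hence zero by minimality. Applied
   to z - z e, this makes e a right unit of M. *)
have ann z : z \in M -> z ** w = 0 -> z = 0.
  move=> zM zw; apply/eqP; rewrite -memv0.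
  suff <- : (M :&: lker (linfun (smulr w)) = 0)%VS.
    by rewrite memv_cap zM memv_ker lfunE /= /smulr zw eqxx.
  apply/eqP/negPn/negP => n0.
  have /(_ n0) eqM := minM _ (left_ideal_annihilator Mid wj) (capvSl _ _).
  have: r \in (M :&: lker (linfun (smulr w)))%VS by rewrite eqM.
  by rewrite memv_cap memv_ker lfunE /= /smulr (negPf rfr) andbF.
have Me z : z \in M -> z ** e = z.
  move=> zM; apply/eqP; rewrite -subr_eq0; apply/eqP; apply: ann.
    by rewrite rpredB // Mi.
  by rewrite smulBl -smulA ew subrr.
have e0 : e != 0.
  by apply: contra rfr => /eqP e0; rewrite -/w -ew e0 smul0 smulr0.
exists e; split=> //; first exact: hprojP.
- exact: Me.
- exact: cM.
move=> l y yl eye y0.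
have yM : y \in M by rewrite -eye Mi.
have ey : e ** y = y by rewrite -eye !smulA (Me e eM).
(* M y contains e y = y, which is nonzero, so M y = M by minimality and e = z y for some z in M. *)
have : e \in (linfun (smulr y) @: M)%VS.
  by rewrite (imgM y l) //; exists e; rewrite ?ey.
case/memv_imgP=> z zM; rewrite lfunE /= /smulr => ezy.
have hzy : hproj B l z ** y = e.
  have := hprojMr false z yl; rewrite -ezy addFb => <-.
  by rewrite hproj_id ?hprojP.
exists (e ** hproj B l z); split.
- by have := hpartM _ _ _ _ (hprojP false e') (hprojP l z).
- by rewrite -!smulA (Me (hproj _ _ _)) ?Mg // smulA Me.
- by rewrite -smulA hzy Me.
Qed.

End LeftIdeals.

(** * Graded division algebras over an algebraically closed field *)

Section ClosedField.

Variables (K : closedFieldType) (B : superAlgType K) (c : B).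
Hypotheses (c_central : forall b, c ** b = b ** c) (c_even : c \in hpart false)
  (c_idem : c ** c = c) (c_neq0 : c != 0) (c_prime : graded_prime c).

Lemma sqrt_exists (a : K) : exists t, t ^+ 2 = a.
Proof.
have /closed_rootP[t] : size ('X^2 - a%:P : {poly K}) != 1%N.
  by rewrite size_XnsubC.
by rewrite /root !hornerE subr_eq0 => /eqP; exists t.
Qed.

(** Multiplication by an even y of e B e has an eigenvector, which is invertible, so y is a scalar.
    Multiplication by one fixed odd element reduces the odd part to the even one. *)
Lemma corner_structure :
  exists e : B, [/\ e \in hpart false, e != 0, e ** e = e, c ** e = e &
    (forall b, b \in hpart false -> e ** b ** e \in <[e]>%VS)
    /\ ((forall b, b \in hpart true -> e ** b ** e = 0)
        \/ exists xi, [/\ xi \in hpart true, e ** xi = xi, xi ** e = xi,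
             xi ** xi = e
             & forall b, b \in hpart true -> e ** b ** e \in <[xi]>%VS])].
Proof.
have [e [ee e0 eI ce inv]] := division_corner c_central c_even c_idem c_neq0
  c_prime.
have eev b : b \in hpart false -> e ** b ** e \in <[e]>%VS.
  move=> bev; set y := e ** b ** e.
  have yev : y \in hpart false by have := hpartM _ _ _ _ (hpartM _ _ _ _ ee
    bev) ee.
  have ey : e ** y = y by rewrite /y !smulA eI.
  have ye : y ** e = y by rewrite /y -!smulA eI.
  clearbody y; pose F := linfun (smul e \o smulr e) : 'End(B).
  (* The even part of e B e, stable under right multiplication by y. *)
  pose U := (hpart false :&: lker (F - \1%VF))%VS.
  have UP x : (x \in U) = (x \in hpart false) && (e ** x ** e == x).
    by rewrite memv_cap memv_ker !lfunE /= lfunE /= opp_lfunE id_lfunE subr_eq0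
      /smulr smulA.
  have U0 : U != 0%VS.
    by apply: contra e0 => /eqP U0; rewrite -memv0 -U0 UP ee /= !eI.
  have [x|a [x []]] := @eigenvector_exists K B U (linfun (smulr y)) U0.
    rewrite !UP lfunE /= /smulr => /andP[xev /eqP exe].
    rewrite (hpartM _ _ _ _ xev yev) /= -!smulA ye smulA; apply/eqP;
      congr (_ ** _).
    by rewrite -exe !smulA eI.
  rewrite UP lfunE /= /smulr => /andP[xev /eqP exe] x0 xy.
  have [z [_ _ zx]] := inv false x xev exe x0.
  apply/vlineP; exists a.
  (* From x y = a x and z x = e follows y = z x y = a e. *)
  by rewrite -ey -[in LHS]zx -smulA xy -sscalerAr zx.
exists e; split=> //; split=> //.
case: (classic (exists2 b, b \in hpart true & e ** b ** e != 0)); last first.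
  move=> no; left=> b bo; apply/eqP/negPn/negP => n0; apply: no.
  by exists b.
case=> b bo; set x := e ** b ** e => x0; right.
have xo : x \in hpart true by have := hpartM _ _ _ _ (hpartM _ _ _ _ ee bo) ee.
have ex : e ** x = x by rewrite /x !smulA eI.
have xe : x ** e = x by rewrite /x -!smulA eI.
clearbody x; have /vlineP[a] : e ** (x ** x) ** e \in <[e]>%VS.
  by rewrite eev // (hpartM _ _ _ _ xo xo).
rewrite smulA ex -smulA xe => xx.
have [z [_ _ zx]] := inv true x xo (etrans (congr1 (smul^~ e) ex) xe) x0.
(* Since x x = a e and z x = e, a = 0 would give x = z x x = 0. Thus x can be rescaled to have
   square e. *)
have a0 : a != 0.
  apply: contra x0 => /eqP a0; rewrite -ex -zx -smulA xx a0 scale0r smulr0.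
  exact: eqxx.
have [t t2] := sqrt_exists a^-1.
have x2 : (t *: x) ** (t *: x) = e.
  by rewrite -sscalerAl -sscalerAr scalerA -expr2 t2 xx scalerA mulVf //
    scale1r.
exists (t *: x); split=> //.
- by rewrite rpredZ.
- by rewrite -sscalerAr ex.
- by rewrite -sscalerAl xe.
move=> d dodd.
(* Times the odd square root [t *: x] of e, an odd d becomes even; multiplying the result q e by
   that root again recovers e d e. *)
have /vlineP[q] : e ** (d ** (e ** (t *: x))) ** e \in <[e]>%VS.
  apply: eev; apply: (hpartM true true) => //.
  by apply: (hpartM false true); rewrite ?rpredZ.
rewrite !smulA -[_ ** _ ** e]smulA -sscalerAl xe => dx.
apply/vlineP; exists q.
have ->: e ** d ** e = e ** d ** e ** (t *: x) ** (t *: x).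
  by rewrite -[RHS]smulA x2 -[RHS]smulA eI.
by rewrite dx -sscalerAl -sscalerAr ex.
Qed.

End ClosedField.

(** * Matrix units *)

(* [f] identifies [D] with the non-unital subalgebra [c A] of [A]. *)
Definition corner_embedding (K : fieldType) (D A : superAlgType K) (c : A)
    (f : D -> A) : Prop :=
  [/\ injective f, {morph f : x y / x ** y}, graded_map f, f sone = c
    & forall a, c ** a = a -> exists d, a = f d].

Section MatrixUnits.

Variables (K : fieldType) (B : superAlgType K).
Variables (r : nat) (u v : 'I_r -> B) (d : 'I_r -> bool) (e c : B).
Hypotheses (u_deg : forall k, u k \in hpart (d k))
  (v_deg : forall k, v k \in hpart (d k))
  (ue : forall k, u k ** e = u k) (ev : forall k, e ** v k = v k)
  (vu : forall k l, v k ** u l = (k == l)%:R *: e)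
  (uv : \sum_k u k ** v k = c) (c_central : forall b, c ** b = b ** c).

(** [u k ** w ** v l] is the matrix unit E_kl with coefficient w in e B e: w = e serves Mat(n|m) and
    the even half of Q(n), w = xi the odd half. *)
Definition munits (w : B) (X : 'M[K]_r) : B :=
  \sum_k \sum_l X k l *: (u k ** w ** v l).

Fact munits_linear w : linear (munits w).
Proof.
move=> a X Y; rewrite /munits scaler_sumr -big_split; apply: eq_bigr => k _ /=.
rewrite scaler_sumr -big_split; apply: eq_bigr => l _ /=.
by rewrite !mxE scalerDl scalerA.
Qed.
HB.instance Definition _ w :=
  GRing.isLinear.Build K 'M[K]_r B _ (munits w) (munits_linear w).

Lemma v_munits w X k : e ** w = w ->
  v k ** munits w X = \sum_l X k l *: (w ** v l).
Proof.
move=> ew; rewrite /munits smul_sumr (bigD1 k) //= [X in _ + X]big1 ?addr0 =>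
  [|j jk].
  rewrite smul_sumr; apply: eq_bigr => l _.
  by rewrite -sscalerAr !smulA vu eqxx scale1r ew.
rewrite smul_sumr big1 // => l _.
by rewrite -sscalerAr !smulA vu eq_sym (negPf jk) scale0r !smul0 scaler0.
Qed.

Lemma munits_entry w X k l : e ** w = w -> w ** e = w ->
  v k ** munits w X ** u l = X k l *: w.
Proof.
move=> ew we; rewrite v_munits // smul_suml (bigD1 l) //= big1 ?addr0 => [|j
  jl].
  by rewrite -sscalerAl -smulA vu eqxx scale1r we.
by rewrite -sscalerAl -smulA vu (negPf jl) scale0r smulr0 scaler0.
Qed.

Lemma munitsM w w' X Y : e ** w' = w' ->
  munits w X ** munits w' Y = munits (w ** w') (X *m Y).
Proof.
move=> ew'; rewrite {1}/munits smul_suml; apply: eq_bigr => k _.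
rewrite smul_suml.
transitivity (\sum_l \sum_j (X k l * Y l j) *: (u k ** (w ** w') ** v j)).
  apply: eq_bigr => l _; rewrite -sscalerAl -(smulA (u k ** w)) v_munits //
    smul_sumr.
  rewrite scaler_sumr; apply: eq_bigr => j _.
  by rewrite -sscalerAr scalerA !smulA.
rewrite exchange_big; apply: eq_bigr => l _ /=.
by rewrite mxE scaler_suml.
Qed.

Lemma munits_expand b : c ** b = b ->
  b = \sum_k \sum_l u k ** (v k ** b ** u l) ** v l.
Proof.
move=> cb; have {1}-> : b = c ** b ** c by rewrite cb -c_central cb.
rewrite -uv !smul_suml; apply: eq_bigr => k _.
rewrite smul_sumr; apply: eq_bigr => l _.
by rewrite !smulA.
Qed.

Lemma munits1 : munits e 1%:M = c.
Proof.
rewrite -uv; apply: eq_bigr => k _; rewrite (bigD1 k) //= big1 => [|l lk].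
  by rewrite mxE eqxx scale1r addr0 ue.
by rewrite mxE eq_sym (negPf lk) scale0r.
Qed.

Lemma munits_graded w (X : 'M_r) i j : w \in hpart j ->
  (forall k l, X k l != 0 -> d k (+) j (+) d l = i) -> munits w X \in hpart i.
Proof.
move=> wj Xi; apply: rpred_sum => k _; apply: rpred_sum => l _.
have [->|/Xi <-] := eqVneq (X k l) 0; first by rewrite scale0r mem0v.
by rewrite rpredZ // (hpartM _ _ _ _ (hpartM _ _ _ _ (u_deg k) wj) (v_deg l)).
Qed.

(** Moving v_k in front of u_k w costs (-1)^((d k + j) d k). For j = 0 this is (-1)^(d k), which
    turns the trace into the supertrace. *)
Lemma munits_form (theta : {scalar B}) w (X : 'M_r) j :
  (forall i j x y, x \in hpart i -> y \in hpart j ->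
        theta (x ** y) = (-1) ^+ (i && j) * theta (y ** x)) ->
  w \in hpart j -> e ** w = w ->
  theta (munits w X) = theta w * \sum_k (-1) ^+ ((d k (+) j) && d k) * X k k.
Proof.
move=> sym wj ew; rewrite /munits linear_sum mulr_sumr; apply: eq_bigr => k _.
rewrite linear_sum (bigD1 k) //= big1 ?addr0 => [|l lk].
  rewrite linearZ /= (sym _ _ _ _ (hpartM _ _ _ _ (u_deg k) wj) (v_deg k)).
  rewrite smulA vu eqxx scale1r ew.
  by rewrite mulrC -mulrA mulrCA.
rewrite linearZ /= (sym _ _ _ _ (hpartM _ _ _ _ (u_deg k) wj) (v_deg l)).
by rewrite smulA vu (negPf lk) scale0r smul0 linear0 !mulr0.
Qed.

End MatrixUnits.

Section DualBasis.

Variables (K : fieldType) (B : superAlgType K) (c e : B).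
Hypotheses (c_prime : graded_prime c) (c_even : c \in hpart false)
  (e_even : e \in hpart false) (e0 : e != 0) (ee : e ** e = e) (ce :
    c ** e = e).

(** Primeness with Y = e, applied to each homogeneous component of x. *)
Lemma corner_faithfulr x : c ** x = x -> (forall y, e ** y ** x = 0) -> x = 0.
Proof.
move=> cx exy; rewrite -(hproj_sum x).
suff h0 i : hproj B i x = 0 by rewrite !h0 addr0.
have ci : c ** hproj B i x = hproj B i x by rewrite -[in RHS]cx (hprojMl _ _
  c_even).
suff fx f : e ** f ** hproj B i x = 0.
  by have [//|/eqP] := c_prime (hprojP i x) e_even ci ce fx; rewrite (negPf e0).
rewrite -(hproj_sum f) smulDr smulDl.
have z k : e ** hproj B k f ** hproj B i x = 0.
  have ek : e ** hproj B k f \in hpart k by have :=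
    hpartM _ _ _ _ e_even (hprojP k f).
  by have := hprojMl (k (+) i) x ek; rewrite exy linear0 addKb.
by rewrite !z addr0.
Qed.

Lemma corner_faithfull z : z \in hpart false -> c ** z = z ->
  (forall y, z ** y ** e = 0) -> z = 0.
Proof.
move=> zev cz zye.
by have [/eqP|] := c_prime e_even zev ce cz zye; first rewrite (negPf e0).
Qed.

(** The last hypothesis, combined with faithfulness, says that kappa (y x) separates the span of u.
    It is left open here because its proof depends on whether e B e has an odd part. *)
Lemma corner_dual_basis r (u : 'I_r -> B) (d : 'I_r -> bool) (kappa :
  {scalar B}) :
  (forall k, u k \in hpart (d k)) -> (forall k, c ** u k = u k) ->
  (forall a : 'I_r -> K, \sum_k a k *: u k = 0 -> forall k, a k = 0) ->
  (forall b, b \in hpart true -> kappa b = 0) ->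
  (forall b, kappa (e ** b) = kappa b) ->
  (forall a : 'I_r -> K, (forall y, kappa (y ** \sum_k a k *: u k) = 0) ->
     forall y, e ** y ** (\sum_k a k *: u k) = 0) ->
  exists v : 'I_r -> B, [/\ forall k, v k \in hpart (d k),
    forall k, e ** v k = v k & forall k l, kappa (v k ** u l) = (k == l)%:R].
Proof.
move=> u_deg cu u_free kodd ke sep.
have [|y yu] := @dual_family _ _ kappa _ u.
  move=> a ya; apply: u_free; apply: corner_faithfulr; last exact: sep.
  by rewrite smul_sumr; apply: eq_bigr => k _; rewrite -sscalerAr cu.
(* Keeping the component of degree d k and multiplying by e preserves the pairing, as kappa kills
   odd elements and kappa (e b) = kappa b. *)
exists (fun k => e ** hproj B (d k) (y k)); split=> k.
- by have := hpartM _ _ _ _ e_even (hprojP (d k) (y k)).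
- by rewrite smulA ee.
move=> l; rewrite -smulA ke; have [dkl|dkl] := eqVneq (d k) (d l).
  rewrite -yu -[in RHS](hproj_sumi (d k) (y k)) smulDl linearD /=.
  rewrite [X in _ = _ + X]kodd ?addr0 //.
  by have := hpartM _ _ _ _ (hprojP (~~ d k) (y k)) (u_deg l);
    rewrite dkl addNb addbb.
rewrite kodd; first by case: (k =P l) dkl => [->|]; rewrite ?eqxx.
have := hpartM _ _ _ _ (hprojP (d k) (y k)) (u_deg l).
by move: dkl; rewrite -negb_add negbK => ->.
Qed.

End DualBasis.

Definition supersymmetric (K : fieldType) (B : superAlgType K) (theta : B ->
  K) : Prop :=
  forall i j x y, x \in hpart i -> y \in hpart j ->
    theta (x ** y) = (-1) ^+ (i && j) * theta (y ** x).

Section CardyFun.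

Variables (K : fieldType) (B : superAlgType K).
Implicit Types X Y f : B.

Fact cardy_fun_linear X Y : linear (cardy_fun X Y).
Proof.
move=> a f g; rewrite /cardy_fun scaler_sumr -big_split; apply: eq_bigr => i _.
rewrite /= scaler_sumr -big_split; apply: eq_bigr => j _.
rewrite /= scaler_sumr -big_split; apply: eq_bigr => k _ /=.
rewrite linearP smulDr smulDl scalerDr -sscalerAr -sscalerAl !scalerA.
by rewrite mulrC.
Qed.
HB.instance Definition _ X Y :=
  GRing.isLinear.Build K B B _ (cardy_fun X Y) (cardy_fun_linear X Y).

Lemma cardy_fun_homog i j X Y f : X \in hpart i -> Y \in hpart j ->
  cardy_fun X Y f =
    \sum_(k : bool) (-1) ^+ ((i && j) + (i && k)) *: (Y ** hproj B k f ** X).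
Proof.
move=> Xi Yj; rewrite /cardy_fun (bigD1 i) //= [X in _ + X]big1 => [|i' ne];
  last first.
  rewrite big1 // => j' _; rewrite big1 // => k _.
  by rewrite (hprojE _ Xi) eq_sym (negPf ne) smulr0 scaler0.
rewrite addr0 (bigD1 j) //= [X in _ + X]big1 => [|j' ne]; last first.
  rewrite big1 // => k _.
  by rewrite (hprojE _ Yj) eq_sym (negPf ne) !smul0 scaler0.
by rewrite addr0; apply: eq_bigr => k _; rewrite (hproj_id Xi) (hproj_id Yj).
Qed.

(** The Cardy maps evaluated below have rank at most one in each parity; a vanishing component is
    covered by phi = 0 and w = 0. *)
Lemma str_rank1 (T : 'End(B)) (phi0 phi1 : {scalar B}) (w0 w1 : B) :
  (forall f, hproj B false (T (hproj B false f)) = phi0 f *: w0) ->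
  (forall f, hproj B true (T (hproj B true f)) = phi1 f *: w1) ->
  str T = phi0 w0 - phi1 w1.
Proof.
move=> T0 T1; rewrite /str; congr (_ - _); apply: lftrace_rank1 => f.
  by rewrite !comp_lfunE T0.
by rewrite !comp_lfunE T1.
Qed.

End CardyFun.

(** * Matrix structure of a prime corner *)

Section Corners.

Variables (K : fieldType) (B : superAlgType K) (c e : B).
Hypotheses (c_prime : graded_prime c) (c_even : c \in hpart false)
  (c_central : forall b, c ** b = b ** c) (c_idem : c ** c = c)
  (e_even : e \in hpart false) (e0 : e != 0) (ee : e ** e = e) (ce : c ** e = e)
  (e_line : forall b, b \in hpart false -> e ** b ** e \in <[e]>%VS).

(** Written as a composition so that linearity is inherited. With w = e this is [kappa], with w = xi
    the functional [lambda] of the Q(n) case. *)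
Definition corner_coef (w : B) (i : bool) : B -> K :=
  coef w \o smul e \o smulr e \o hproj B i.
HB.instance Definition _ w i := GRing.Linear.copy (corner_coef w i)
  (coef w \o smul e \o smulr e \o hproj B i).

Lemma corner_coefE w i b : w \in hpart i ->
  (forall b, b \in hpart i -> e ** b ** e \in <[w]>%VS) ->
  e ** hproj B i b ** e = corner_coef w i b *: w.
Proof. by move=> wi wl; rewrite /corner_coef /= /smulr smulA coefK //
  wl ?hprojP. Qed.

Lemma corner_coef_id w i : w != 0 -> w \in hpart i -> e ** w = w ->
  w ** e = w ->
  corner_coef w i w = 1.
Proof. by move=> w0 wi ew we; rewrite /corner_coef /= /smulr hproj_id //
  we ew coef_id. Qed.

Let kappa : {scalar B} := corner_coef e false.

Lemma kappa_odd b : b \in hpart true -> kappa b = 0.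
Proof. by move=> bo; rewrite /kappa /= /corner_coef /= (hprojE _ bo) !linear0.
  Qed.

Lemma kappa_e b : kappa (e ** b) = kappa b.
Proof.
by rewrite /kappa /= /corner_coef /= (hprojMl _ _ e_even) /smulr !smulA ee.
Qed.

Lemma left_corner_c x : x ** e = x -> c ** x = x.
Proof. by move=> <-; rewrite smulA c_central -smulA ce. Qed.

(** The difference of the two sides is even, because u_k and v_k have equal degree, and it kills B
    e; faithfulness makes it zero. *)
Lemma dual_sum r (u v : 'I_r -> B) (d : 'I_r -> bool) :
  (forall k, u k \in hpart (d k)) -> (forall k, v k \in hpart (d k)) ->
  (forall k, u k ** e = u k) ->
  (forall y, (\sum_k u k ** v k) ** (y ** e) = y ** e) ->
  \sum_k u k ** v k = c.
Proof.
move=> ud vd ue s_id; apply/eqP; rewrite -subr_eq0; apply/eqP.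
apply: (corner_faithfull c_prime e_even e0 ce).
- rewrite rpredB //; apply: rpred_sum => k _.
  by rewrite -(addbb (d k)) hpartM.
- rewrite smulBr c_idem smul_sumr; congr (_ - _); apply: eq_bigr => k _.
  by rewrite smulA left_corner_c.
by move=> y; rewrite -smulA smulBl s_id left_corner_c ?subrr // -smulA ee.
Qed.

(** B e is the graded module on which c B will act by matrices; as e is idempotent, it is the set of
    fixed points of right multiplication by e. *)
Definition ideal_part (i : bool) : {vspace B} :=
  (hpart i :&: lker (linfun (smulr e) - \1%VF))%VS.

Lemma ideal_partP i x : (x \in ideal_part i) = (x \in hpart i) && (x ** e == x).
Proof. by rewrite memv_cap memv_ker !lfunE /= lfunE /= opp_lfunE id_lfunE
  subr_eq0. Qed.

Let bas i := vbasis (ideal_part i).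

Lemma bas_part i k : (k < \dim (ideal_part i))%N ->
  (bas i)`_k \in hpart i /\ (bas i)`_k ** e = (bas i)`_k.
Proof.
move=> lt; have : (bas i)`_k \in ideal_part i.
  by rewrite vbasis_mem // mem_nth // size_tuple.
by rewrite ideal_partP => /andP[? /eqP].
Qed.

(** * The case e B e = K e: Mat(n|m) *)

Section Matrix.

Hypothesis e_odd : forall b, b \in hpart true -> e ** b ** e = 0.

Lemma corner_kappa b : e ** b ** e = kappa b *: e.
Proof.
rewrite -{1}(hproj_sum b) smulDr smulDl [X in _ + X]e_odd ?hprojP // addr0.
exact: corner_coefE.
Qed.

(** On even f the map is kappa f *: e, of trace kappa e = 1; on odd f it vanishes. *)
Lemma str_cardy_even : str (linfun (cardy_fun e e)) = 1.
Proof.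
rewrite (str_rank1 (phi0 := kappa) (w0 := e) (phi1 := \0) (w1 := 0)).
- by rewrite subr0 /kappa /= corner_coef_id.
- move=> f; rewrite lfunE /= (cardy_fun_homog _ e_even e_even) big_bool /=.
  rewrite !(hprojE _ (hprojP false f)) /= smulr0 smul0 scaler0 add0r scale1r.
  rewrite hproj_id.
    by rewrite corner_kappa /kappa /= /corner_coef /= (hproj_id (hprojP _ _)).
  by rewrite corner_kappa rpredZ.
move=> f; rewrite lfunE /= (cardy_fun_homog _ e_even e_even) big_bool /=.
by rewrite !(hprojE _ (hprojP true f)) /= e_odd ?hprojP //
  smulr0 smul0 !scaler0 addr0 linear0.
Qed.

Let n := \dim (ideal_part false).
Let m := \dim (ideal_part true).

(** Even basis vectors of B e come first, to match the blocks of [smat]. *)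
Definition smat_vec (k : 'I_(n + m)) : B :=
  match split k with inl i => (bas false)`_i | inr j => (bas true)`_j end.
Definition smat_deg (k : 'I_(n + m)) : bool :=
  match split k with inl _ => false | inr _ => true end.

Lemma smat_vec_deg k : smat_vec k \in hpart (smat_deg k).
Proof. by rewrite /smat_vec /smat_deg; case: split => i; have [] :=
  bas_part (ltn_ord i). Qed.

Lemma smat_vec_e k : smat_vec k ** e = smat_vec k.
Proof. by rewrite /smat_vec; case: split => i; have [] :=
  bas_part (ltn_ord i). Qed.

Lemma smat_vec_split (a : 'I_(n + m) -> K) :
  \sum_k a k *: smat_vec k = \sum_(i < n) a (lshift m i) *: (bas false)`_i
                     + \sum_(j < m) a (rshift n j) *: (bas true)`_j.
Proof.
rewrite big_split_ord /smat_vec; congr (_ + _); apply: eq_bigr => i _.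
  by rewrite (unsplitK (inl i)).
by rewrite (unsplitK (inr i)).
Qed.

Lemma smat_vec_free (a : 'I_(n + m) -> K) : \sum_k a k *: smat_vec k = 0 ->
  forall k, a k = 0.
Proof.
rewrite smat_vec_split; set x := (X in X + _ = _); set y :=
  (X in _ + X = _) => xy.
have xev : x \in hpart false.
  by apply: rpred_sum => i _; rewrite rpredZ //; have [] :=
    bas_part (ltn_ord i).
have yod : y \in hpart true.
  by apply: rpred_sum => i _; rewrite rpredZ //; have [] :=
    bas_part (ltn_ord i).
have x0 : x = 0.
  rewrite -(hproj_id xev); have := congr1 (hproj B false) xy.
  by rewrite linearD linear0 /= (hprojE _ yod) addr0.
have y0 : y = 0 by rewrite -xy x0 add0r.
have /freeP fr0 := basis_free (vbasisP (ideal_part false)).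
have /freeP fr1 := basis_free (vbasisP (ideal_part true)).
move=> k; case: (split_ordP k) => i ->.
  exact: (fr0 (fun i => a (lshift m i))).
exact: (fr1 (fun i => a (rshift n i))).
Qed.

Lemma smat_vec_span x : x ** e = x -> exists a : 'I_(n + m) -> K,
  x = \sum_k a k *: smat_vec k.
Proof.
move=> xe.
have hx i : hproj B i x \in ideal_part i.
  rewrite ideal_partP hprojP /=; have := hprojMr i x e_even.
  by rewrite xe addbF => <-.
exists (fun k => match split k with
  | inl i => coord (bas false) i (hproj B false x)
  | inr j => coord (bas true) j (hproj B true x) end).
rewrite smat_vec_split -[LHS]hproj_sum (coord_vbasis (hx false)) (coord_vbasis
  (hx true)).
congr (_ + _); apply: eq_bigr => i _.
  by rewrite (unsplitK (inl i)) -coord_vbasis.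
by rewrite (unsplitK (inr i)) -coord_vbasis.
Qed.

Definition smat_map (v : 'I_(n + m) -> B) (X : smat K n m) : B :=
  munits smat_vec v e X.
HB.instance Definition _ v := GRing.Linear.copy (smat_map v)
  (munits smat_vec v e : 'M_(n + m) -> B).

Lemma smat_entry i (X : smat K n m) k l :
  X \in hpart i -> X k l != 0 -> smat_deg k (+) smat_deg l = i.
Proof.
move/(smat_partP i X) => <-; rewrite /smat_deg /smat_proj.
case: i; rewrite mxE; case: split => k'; rewrite mxE; case: split => l' //;
  by rewrite mxE eqxx.
Qed.

Lemma mxstrE (X : smat K n m) :
  mxstr X = \sum_k (-1) ^+ ((smat_deg k (+) false) && smat_deg k) * X k k.
Proof.
rewrite big_split_ord /mxstr /mxtrace /smat_deg -sumrN; congr (_ + _); apply: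
  eq_bigr => i _.
  by rewrite !mxE (unsplitK (inl i)) mul1r.
by rewrite !mxE (unsplitK (inr i)) mulN1r.
Qed.

Lemma smat_embedding : exists g : {linear smat K n m -> B},
  corner_embedding c g
  /\ forall theta : {scalar B}, supersymmetric theta ->
       forall X, theta (g X) = theta e * mxstr X.
Proof.
have cu k : c ** smat_vec k = smat_vec k by rewrite left_corner_c // smat_vec_e.
have [|v [v_deg ev kvu]] := corner_dual_basis c_prime c_even e_even e0 ee ce
  smat_vec_deg cu smat_vec_free kappa_odd kappa_e.
  move=> a kx y; set x := \sum_k _ in kx *.
  have xe : x ** e = x.
    by rewrite smul_suml; apply: eq_bigr => k _; rewrite -sscalerAl smat_vec_e.
  (* As x = x e, e y x = e (y x) e = kappa (y x) e. *)
  by rewrite -xe smulA -(smulA e) corner_kappa kx scale0r.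
have vu k l : v k ** smat_vec l = (k == l)%:R *: e.
  by rewrite -kvu -corner_kappa smulA ev -smulA smat_vec_e.
have uv : \sum_k smat_vec k ** v k = c.
  apply: (dual_sum smat_vec_deg v_deg smat_vec_e) => y.
  have [|a ->] := @smat_vec_span (y ** e); first by rewrite -smulA ee.
  rewrite smul_sumr; apply: eq_bigr => k _; rewrite -sscalerAr; congr (_ *: _).
  rewrite smul_suml (bigD1 k) //= big1 ?addr0 => [|l lk].
    by rewrite -smulA vu eqxx scale1r smat_vec_e.
  by rewrite -smulA vu (negPf lk) scale0r smulr0.
exists (smat_map v); split; last first.
  move=> theta sym X; rewrite mxstrE.
  exact: (munits_form smat_vec_deg v_deg vu X sym e_even ee).
have entry X k l : v k ** smat_map v X ** smat_vec l = X k l *: e.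
  exact: (munits_entry vu).
split.
- move=> X Y XY; apply/matrixP => k l.
  have : X k l *: e = Y k l *: e by rewrite -!entry XY.
  by move/(congr1 (coef e)); rewrite !linearZ /= coef_id // !mulr1.
- by move=> X Y; rewrite /smat_map (munitsM vu) // ee.
- move=> i X Xi; apply: (munits_graded smat_vec_deg v_deg e_even) => k l Xkl.
  by rewrite addbF; apply: smat_entry Xi Xkl.
- exact: (munits1 smat_vec_e uv).
(* v_k b u_l lies in e B e = K e, and its coefficient is the matrix entry. *)
move=> b cb; exists (\matrix_(k, l) kappa (v k ** b ** smat_vec l) :
  smat K n m).
rewrite [LHS](munits_expand uv c_central cb); apply: eq_bigr => k _.
apply: eq_bigr => l _; rewrite mxE.
have -> : v k ** b ** smat_vec l = kappa (v k ** b ** smat_vec l) *: e.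
  by rewrite -corner_kappa !smulA ev -!smulA smat_vec_e.
by rewrite -sscalerAr -sscalerAl linearZ /= (corner_coef_id e0) ?mulr1.
Qed.

End Matrix.

(** * The case e B e = K e + K xi: Q(n) *)

Section Queer.

Variable xi : B.
Hypotheses (xi_odd : xi \in hpart true) (exi : e ** xi = xi) (xie :
  xi ** e = xi)
  (xixi : xi ** xi = e)
  (xi_line : forall b, b \in hpart true -> e ** b ** e \in <[xi]>%VS).

(** A coordinate functional, distinct from the scalar theta_A(e) that bears the same name in the
    elementary algebras. *)
Let lambda : {scalar B} := corner_coef xi true.

Lemma xi0 : xi != 0.
Proof. by apply: contra e0 => /eqP x0; rewrite -xixi x0 smul0. Qed.

Lemma corner_kappa_lambda b : e ** b ** e = kappa b *: e + lambda b *: xi.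
Proof.
rewrite -{1}(hproj_sum b) smulDr smulDl.
by rewrite (corner_coefE _ e_even) // (corner_coefE _ xi_odd).
Qed.

(** For even f the sign is -1 and the map is - kappa f *: e; for odd f the signs cancel and it is
    lambda f *: xi. The supertrace is thus -1 - 1. *)
Lemma str_cardy_odd : str (linfun (cardy_fun xi xi)) = - 2%:R.
Proof.
have xfx f : xi ** f ** xi = xi ** (e ** f ** e) ** xi.
  by rewrite !smulA xie -!smulA exi.
rewrite (str_rank1 (phi0 := \- kappa) (w0 := e) (phi1 := lambda) (w1 := xi)).
- by rewrite /= !corner_coef_id ?xi0 // -opprD.
- move=> f; rewrite lfunE /= (cardy_fun_homog _ xi_odd xi_odd) big_bool /=.
  rewrite !(hprojE _ (hprojP false f)) /= smulr0 smul0 scaler0 add0r expr1.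
  rewrite xfx (corner_coefE _ e_even) //.
  by rewrite -sscalerAr -sscalerAl xie xixi scaleN1r linearN /= linearZ /=
    hproj_id // scaleNr.
move=> f; rewrite lfunE /= (cardy_fun_homog _ xi_odd xi_odd) big_bool /=.
rewrite !(hprojE _ (hprojP true f)) /= smulr0 smul0 scaler0 addr0 sqrrN expr1n
  scale1r.
rewrite xfx (corner_coefE _ xi_odd) //.
by rewrite -sscalerAr -sscalerAl xixi exi linearZ /= hproj_id.
Qed.

Let n := \dim (ideal_part false).
(** Right multiplication by xi exchanges the two parts of B e, so a basis of the even part is a
    basis over K e + K xi. *)
Definition qmat_vec (k : 'I_n) : B := (bas false)`_k.

Lemma qmat_vec_deg k : qmat_vec k \in hpart false.
Proof. by have [] := bas_part (ltn_ord k). Qed.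
Lemma qmat_vec_e k : qmat_vec k ** e = qmat_vec k.
Proof. by have [] := bas_part (ltn_ord k). Qed.

Definition qmat_map (v : 'I_n -> B) (Z : qmat K n) : B :=
  munits qmat_vec v e Z.1 + munits qmat_vec v xi Z.2.
Fact qmat_map_linear v : linear (qmat_map v).
Proof. by move=> a X Y; rewrite /qmat_map !linearP scalerDr addrACA. Qed.
HB.instance Definition _ v :=
  GRing.isLinear.Build K (qmat K n) B _ (qmat_map v) (qmat_map_linear v).

Lemma qmat_embedding : exists g : {linear qmat K n -> B},
  corner_embedding c g
  /\ forall theta : {scalar B}, supersymmetric theta -> 2%:R != 0 :> K ->
       forall X, theta (g X) = theta xi * qtr X.
Proof.
have cu k : c ** qmat_vec k = qmat_vec k by rewrite left_corner_c // qmat_vec_e.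
have /freeP fr := basis_free (vbasisP (ideal_part false)).
have [|v [v_deg ev kvu]] := corner_dual_basis c_prime c_even e_even e0 ee ce
  qmat_vec_deg cu fr kappa_odd kappa_e.
  move=> a kx y; set x := \sum_k _ in kx *.
  have xe : x ** e = x.
    by rewrite smul_suml; apply: eq_bigr => k _; rewrite -sscalerAl qmat_vec_e.
  have eyx : e ** y ** x = lambda (y ** x) *: xi.
    by rewrite -xe smulA -(smulA e) corner_kappa_lambda xe kx scale0r add0r.
  (* Testing against xi y turns the xi-coefficient of e y x into an e-coefficient, which kappa
     detects. *)
  rewrite eyx; have := kx (xi ** y).
  rewrite -xie -(smulA xi) -(smulA xi) eyx -sscalerAr xixi linearZ /=.
  by rewrite (corner_coef_id e0) // mulr1 => ->; rewrite scale0r.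
have vu k l : v k ** qmat_vec l = (k == l)%:R *: e.
  have ev_even : v k ** qmat_vec l \in hpart false by have :=
    hpartM _ _ _ _ (v_deg k) (qmat_vec_deg l).
  rewrite -kvu -(corner_coefE _ e_even e_line) (hproj_id ev_even).
  by rewrite smulA ev -smulA qmat_vec_e.
have uv_id x : x \in hpart false -> x ** e = x ->
  (\sum_k qmat_vec k ** v k) ** x = x.
  move=> xev xe; have xI : x \in ideal_part false by rewrite ideal_partP xev xe
    /=.
  rewrite {1 2}(coord_vbasis xI).
  rewrite smul_sumr; apply: eq_bigr => k _; rewrite -sscalerAr; congr (_ *: _).
  rewrite smul_suml (bigD1 k) //= big1 ?addr0 => [|l lk].
    by rewrite -smulA vu eqxx scale1r qmat_vec_e.
  by rewrite -smulA vu (negPf lk) scale0r smulr0.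
have uv : \sum_k qmat_vec k ** v k = c.
  apply: (dual_sum qmat_vec_deg v_deg qmat_vec_e) => y.
  rewrite -(hproj_sum y) smulDl smulDr uv_id; last 2 first.
  - by have := hpartM _ _ _ _ (hprojP false y) e_even.
  - by rewrite -smulA ee.
  (* For odd y, y e = (y xi) xi with y xi in the even part of B e, where the identity is already
     known. *)
  congr (_ + _); rewrite -xixi (smulA (hproj B true y)) smulA uv_id //.
    by have := hpartM _ _ _ _ (hprojP true y) xi_odd.
  by rewrite -smulA xie.
exists (qmat_map v); split; last first.
  move=> theta sym n2 X; rewrite linearD /=.
  rewrite (munits_form qmat_vec_deg v_deg vu _ sym e_even ee).
  rewrite (munits_form qmat_vec_deg v_deg vu _ sym xi_odd exi).
  (* As xi is odd, theta (xi xi) = - theta (xi xi), that is 2 theta e = 0; so the even half of Q(n)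
     contributes nothing. *)
  have -> : theta e = 0.
    have /eqP := sym _ _ _ _ xi_odd xi_odd; rewrite xixi /= mulN1r -subr_eq0
      opprK.
    by rewrite -mulr2n -mulr_natl mulf_eq0 (negPf n2) => /eqP.
  rewrite mul0r add0r; congr (_ * _); apply: eq_bigr => k _.
  by rewrite mul1r.
have entry X k l : v k ** qmat_map v X ** qmat_vec l = X.1 k l *:
  e + X.2 k l *: xi.
  by rewrite /qmat_map smulDr smulDl !(munits_entry vu).
split.
- move=> X Y XY.
  have eqkl k l : X.1 k l *: e + X.2 k l *: xi = Y.1 k l *: e + Y.2 k l *: xi.
    by rewrite -!entry XY.
  have eX : X.1 = Y.1.
    apply/matrixP => k l; have := congr1 kappa (eqkl k l).
    by rewrite !linearD !linearZ /= (kappa_odd xi_odd) !mulr0 !addr0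
      (corner_coef_id e0) ?mulr1.
  rewrite [X]surjective_pairing [Y]surjective_pairing eX; congr pair.
  apply/matrixP => k l; have := eqkl k l; rewrite eX => /addrI/(congr1 (coef
    xi)).
  by rewrite !linearZ /= coef_id ?xi0 // !mulr1.
- move=> X Y; rewrite -[X ** Y]/(qmul X Y) /qmat_map smulDl !smulDr !(munitsM
  vu) // ee exi xie xixi.
  rewrite -[LHS]/(munits qmat_vec v e (X.1 *m Y.1 + X.2 *m Y.2)
                  + munits qmat_vec v xi (X.1 *m Y.2 + X.2 *m Y.1)).
  by rewrite !linearD /= addrACA; congr (_ + _); exact: addrC.
- move=> i X /(qmat_partP i X) <-; case: i => /=.
    rewrite -[qmat_map _ _]/(munits qmat_vec v e 0 + munits qmat_vec v xi X.2)
      linear0 add0r.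
    exact: (munits_graded qmat_vec_deg v_deg xi_odd).
  rewrite -[qmat_map _ _]/(munits qmat_vec v e X.1 + munits qmat_vec v xi 0)
    linear0 addr0.
  exact: (munits_graded qmat_vec_deg v_deg e_even).
- rewrite -[LHS]/(munits qmat_vec v e 1%:M + munits qmat_vec v xi 0) linear0
  addr0.
  exact: (munits1 qmat_vec_e uv).
move=> b cb.
pose X : 'M_n := \matrix_(k, l) kappa (v k ** b ** qmat_vec l).
pose Y : 'M_n := \matrix_(k, l) lambda (v k ** b ** qmat_vec l).
exists (X, Y); rewrite -[RHS]/(munits qmat_vec v e X + munits qmat_vec v xi Y).
rewrite [LHS](munits_expand uv c_central cb) /munits -big_split.
apply: eq_bigr => k _; rewrite -big_split; apply: eq_bigr => l _;
  rewrite /= !mxE.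
have {1}-> : v k ** b ** qmat_vec l
    = kappa (v k ** b ** qmat_vec l) *: e + lambda (v k ** b ** qmat_vec l) *:
      xi.
  by rewrite -corner_kappa_lambda !smulA ev -!smulA qmat_vec_e.
by rewrite smulDr smulDl -!sscalerAr -!sscalerAl.
Qed.

End Queer.

End Corners.

(** * Splitting of the bulk algebra *)

Definition orthogonal (K : fieldType) (A : superAlgType K) (x y : A) : bool :=
  (x ** y == 0) && (y ** x == 0).

Section Splitting.

Variable K : closedFieldType.
Hypothesis char_not2 : 2%:R != 0 :> K.
Implicit Types A B : superAlgType K.

Definition split_idempotent A (e : A) : Prop :=
  [/\ e \in hpart false, e != 0, e ** e = e & forall a, exists k, e ** a = k *:
    e].

Definition split_system A (es : seq A) : Prop :=
  [/\ \sum_(e <- es) e = sone, {in es, forall e, split_idempotent e}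
    & pairwise (@orthogonal _ A) es].

Lemma graded_idealP A (I : {vspace A}) :
  (forall i x, x \in I -> hproj A i x \in I) ->
  I = ((I :&: hpart false) + (I :&: hpart true))%VS.
Proof.
move=> Ig; apply/eqP; rewrite eqEsubv subv_add !capvSl !andbT.
apply/subvP=> x xI; rewrite -(hproj_sum x).
by rewrite memv_add // memv_cap Ig ?hprojP.
Qed.

(** An odd x squares to zero, so the graded ideal x A misses the unit and x = 0. Then A is even and
    commutative, and the kernel of a - k, for an eigenvalue k of a, is a nonzero ideal, hence A. *)
Lemma simple_supercommutative A : simple_superalg A -> supercommutative A ->
  forall a : A, a \in hpart false /\ exists k, a = k *: sone.
Proof.
move=> [one0 simpleA] scA.
have ideal0 (I : {vspace A}) : graded_ideal I -> sone \notin I -> I = 0%VS.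
  by move=> Ii nI; have [//|IT] := simpleA I Ii; rewrite IT memvf in nI.
have odd0 (x : A) : x \in hpart true -> x = 0.
  move=> xo; have xx : x ** x = 0.
    have /eqP := scA _ _ _ _ xo xo; rewrite scaleN1r -addr_eq0 -mulr2n
      -scaler_nat.
    by rewrite scaler_eq0 (negPf char_not2) => /eqP.
  suff I0 : limg (linfun (smul x)) = 0%VS.
    apply/eqP; rewrite -memv0 -I0 -[X in X \in _]smul1r -[x ** _](lfunE (smul
      x)).
    by rewrite memv_img ?memvf.
  apply: ideal0; last first.
    apply/negP => /memv_imgP[m _]; rewrite lfunE /= => one.
    apply: one0; suff x0 : x = 0 by rewrite one x0 smul0.
    by rewrite -[x]smul1r one smulA xx smul0.
  split.
    apply: graded_idealP => i y /memv_imgP[m _ ->].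
    by rewrite lfunE /= (hprojMl _ _ xo) -[x ** _](lfunE (smul x)) memv_img
      ?memvf.
  move=> a y /memv_imgP[m _ ->]; rewrite lfunE /= smulA; split; last first.
    by rewrite -smulA -[x ** _](lfunE (smul x)) memv_img ?memvf.
  (* Supercommutativity moves x to the left at the price of a sign on the odd part of a; this makes
     x A two-sided. *)
  have -> : a ** x = x ** (hproj A false a - hproj A true a).
    rewrite -{1}(hproj_sum a) smulDl !(scA _ _ _ _ (hprojP _ a) xo) /=.
    by rewrite scale1r scaleN1r smulBr.
  by rewrite -smulA -[x ** _](lfunE (smul x)) memv_img ?memvf.
have even (a : A) : a \in hpart false.
  by rewrite -(hproj_sum a) (odd0 _ (hprojP true a)) addr0 hprojP.
have comm (a b : A) : a ** b = b ** a.
  by rewrite (scA _ _ _ _ (even a) (even b)) scale1r.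
move=> a; split=> //.
have [| |k [x [_ x0]]] := @eigenvector_exists K A fullv (linfun (smul a)).
- by apply: contra_not_neq one0 => f0; apply/eqP; rewrite -memv0 -f0 memvf.
- by move=> x _; rewrite memvf.
rewrite lfunE /= => ax; exists k.
pose I := lker (linfun (smul (a - k *: sone))).
have IP (y : A) : (y \in I) = (a ** y == k *: y).
  by rewrite memv_ker lfunE /= smulBl -sscalerAl smul1l subr_eq0.
have Ii : graded_ideal I.
  split; first apply: graded_idealP => i y yI.
    by rewrite (hprojE _ (even y)); case: eqP; rewrite ?mem0v.
  move=> b y; rewrite (comm y b) !IP => /eqP ay.
  by rewrite smulA (comm a) -smulA ay sscalerAr eqxx.
have [I0|IT] := simpleA I Ii.
  by move: x0; rewrite -memv0 -I0 IP ax eqxx.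
by apply/eqP; rewrite -[X in X == _]smul1r -IP IT memvf.
Qed.

Lemma split_simple A : simple_superalg A -> supercommutative A ->
  @split_system A [:: sone].
Proof.
move=> sA scA; have AE := simple_supercommutative sA scA.
split; rewrite ?big_seq1 // => e; rewrite inE => /eqP->.
split; rewrite ?smul1l //; first by case: (AE sone).
  by case: sA => /eqP.
by move=> a; rewrite smul1l; case: (AE a).
Qed.

Lemma split_prod A B (es : seq A) (fs : seq B) :
  split_system es -> split_system fs ->
  @split_system (A * B)%type ([seq (e, 0) | e <- es] ++ [seq (0, f) | f <- fs]).
Proof.
move=> [sume ide orte] [sumf idf ortf].
have mulE (x y : (A * B)%type) : x ** y = (x.1 ** y.1, x.2 ** y.2) by [].
split.
- rewrite big_cat !big_map /= -[sone]/(sone, sone) -sume -sumf.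
  have -> : \sum_(e <- es) ((e, 0) : A * B) = (\sum_(e <- es) e, 0).
    elim: (es) => [|e s IH]; rewrite ?big_nil // !big_cons IH.
    by congr pair; rewrite /= addr0.
  have -> : \sum_(f <- fs) ((0, f) : A * B) = (0, \sum_(f <- fs) f).
    elim: (fs) => [|f s IH]; rewrite ?big_nil // !big_cons IH.
    by congr pair; rewrite /= addr0.
  by congr pair; rewrite /= ?addr0 ?add0r.
- move=> x; rewrite mem_cat => /orP[] /mapP[e eI ->].
    have [ee e0 eI2 el] := ide e eI; split.
    + by rewrite -[hpart _]/(prod_part A B false) prod_partE /= ee mem0v.
    + by apply: contra e0 => /eqP[->].
    + by rewrite mulE /= eI2 smul0.
    move=> [a b]; have [k ea] := el a; exists k.
    by rewrite mulE /= ea smul0; congr pair; rewrite /= scaler0.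
  have [ee e0 eI2 el] := idf e eI; split.
  + by rewrite -[hpart _]/(prod_part A B false) prod_partE /= ee mem0v.
  + by apply: contra e0 => /eqP[->].
  + by rewrite mulE /= eI2 smul0.
  move=> [a b]; have [k eb] := el b; exists k.
  by rewrite mulE /= eb smul0; congr pair; rewrite /= scaler0.
rewrite pairwise_cat; apply/and3P; split.
- apply/allrelP => x y /mapP[e _ ->] /mapP[f _ ->].
  by rewrite /orthogonal !mulE /= !smul0 !smulr0 eqxx.
- rewrite pairwise_map; apply: sub_pairwise orte => x y /andP[/eqP xy /eqP yx].
  by rewrite /orthogonal /= !mulE /= xy yx !smul0 eqxx.
rewrite pairwise_map; apply: sub_pairwise ortf => x y /andP[/eqP xy /eqP yx].
by rewrite /orthogonal /= !mulE /= xy yx !smul0 eqxx.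
Qed.

Lemma split_dsum s : List.Forall (@simple_superalg K) s ->
  supercommutative (superalg_dsum s) -> exists es,
    @split_system (superalg_dsum s) es.
Proof.
elim: s => [|A s IH] /= sims sc.
  (* In Mat(0|0) the unit is 0, the empty sum. *)
  exists [::]; split; rewrite ?big_nil //.
  by apply/matrixP => -[].
have sA : simple_superalg A by inversion sims.
have sims' : List.Forall (@simple_superalg K) s by inversion sims.
have memE i (x : (A * superalg_dsum s)%type) :
    (x \in hpart i) = (x.1 \in hpart i) && (x.2 \in hpart i) by exact:
      prod_partE.
have [|es ess] := IH sims'.
  move=> i j x y xi yj.
  have := sc i j (0, x) (0, y); rewrite !memE /= !mem0v xi yj => /(_ isT isT).
  by move/(congr1 snd).
exists ([seq (e, 0) | e <- [:: sone]] ++ [seq (0, f) | f <- es]).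
apply: split_prod ess; apply: split_simple sA _ => i j x y xi yj.
have := sc i j (x, 0) (y, 0); rewrite !memE /= !mem0v xi yj => /(_ isT isT).
by move/(congr1 fst).
Qed.

(** The inverse is graded because f sends the wrong-degree part of g y to the wrong-degree part of
    y, which is 0. *)
Lemma superalg_iso_inv A B (f : {linear A -> B}) :
  bijective f -> unital_morph f -> graded_map f ->
  exists g : {linear B -> A}, [/\ cancel f g, cancel g f, bijective g,
    unital_morph g
    & graded_map g].
Proof.
move=> [g0 fg0 g0f] [f1 fM] fg.
pose g : {linear B -> A} := (linfun f)^-1%VF.
have finj : lker (linfun f) == 0%VS.
  by apply/lker0P => x y; rewrite !lfunE /= => /(can_inj fg0).
have fK : cancel f g by move=> x; have := lker0_lfunK finj x; rewrite lfunE.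
have gE y : g y = g0 y by rewrite -{1}(g0f y) fK.
have gK : cancel g f by move=> y; rewrite gE g0f.
clearbody g.
exists g; split=> //; first by exists f.
  by split=> [|x y]; rewrite -?f1 ?fK // -{1}(gK x) -{1}(gK y) -fM fK.
move=> i y yi; rewrite -(hproj_sumi i (g y)).
suff -> : hproj A (~~ i) (g y) = 0 by rewrite addr0 hprojP.
apply: (can_inj fK); rewrite linear0.
rewrite -(hproj_id (fg _ _ (hprojP (~~ i) (g y)))).
have := congr1 (hproj B (~~ i)) (congr1 f (hproj_sumi i (g y))).
by rewrite gK (hproj0 yi) !linearD /= (hproj0 (fg _ _ (hprojP i (g y)))) add0r.
Qed.

Lemma split_iso A B (g : {linear B -> A}) (es : seq B) :
  bijective g -> unital_morph g -> graded_map g ->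
  split_system es -> split_system (map g es).
Proof.
move=> [f gK fK] [g1 gM] gg [sumes ides ortes]; split.
- by rewrite big_map -linear_sum sumes g1.
- move=> _ /mapP[e eI ->]; have [ee e0 eI2 el] := ides e eI; split.
  + exact: gg.
  + by apply: contra e0 => /eqP g0; rewrite -(gK e) g0 -(linear0 g) gK.
  + by rewrite -gM eI2.
  move=> a; have [k ea] := el (f a); exists k.
  by rewrite -{1}(fK a) -gM ea linearZ.
rewrite pairwise_map; apply: sub_pairwise ortes => x y /andP[/eqP xy /eqP yx].
by rewrite /orthogonal /= -!gM xy yx !linear0 eqxx.
Qed.

Lemma supercommutative_split A : semisimple_superalg A -> supercommutative A ->
  exists es : seq A, split_system es.
Proof.
move=> [s sims [f [fb fM fg]]] scA.
have [g [fK gK gb gM gg]] := superalg_iso_inv fb fM fg.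
have [|es ess] := split_dsum sims.
  move=> i j x y xi yj; apply: (can_inj gK).
  by rewrite linearZ /= !gM.2; apply: scA; apply: gg.
by exists (map g es); apply: split_iso ess.
Qed.

(** Each a is the sum of the e a, multiples of the even idempotents e, so A is purely even and no
    signs occur. *)
Lemma split_commutative A (es : seq A) : supercommutative A ->
  split_system es ->
  forall a b : A, a ** b = b ** a.
Proof.
move=> scA [sumes ides _].
have even (a : A) : a \in hpart false.
  rewrite -[a]smul1l -sumes smul_suml big_seq; apply: rpred_sum => e eI.
  by have [ee _ _ /(_ a)[k ->]] := ides e eI; rewrite rpredZ.
by move=> a b; rewrite (scA _ _ _ _ (even a) (even b)) scale1r.
Qed.

End Splitting.

(** * Corners of Cardy-Frobenius algebras *)

Section CornerSum.

Variables (K : fieldType) (A D1 D2 : superAlgType K) (c1 c2 : A).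
Variables (f1 : {linear D1 -> A}) (f2 : {linear D2 -> A}).
Hypotheses (emb1 : corner_embedding c1 f1) (emb2 : corner_embedding c2 f2)
  (c12 : c1 ** c2 = 0) (c21 : c2 ** c1 = 0).

Definition corner_sum (x : D1 * D2) : A := f1 x.1 + f2 x.2.

Fact corner_sum_linear : linear corner_sum.
Proof. by move=> a x y; rewrite /corner_sum !linearP scalerDr addrACA. Qed.
HB.instance Definition _ :=
  GRing.isLinear.Build K (D1 * D2)%type A _ corner_sum corner_sum_linear.

Lemma corner_sum_embedding : corner_embedding (c1 + c2) corner_sum.
Proof.
have [inj1 M1 g1 f1c s1] := emb1; have [inj2 M2 g2 f2c s2] := emb2.
have cf1 x : c1 ** f1 x = f1 x by rewrite -f1c -M1 smul1l.
have cf2 x : c2 ** f2 x = f2 x by rewrite -f2c -M2 smul1l.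
have fc1 x : f1 x ** c1 = f1 x by rewrite -f1c -M1 smul1r.
have fc2 x : f2 x ** c2 = f2 x by rewrite -f2c -M2 smul1r.
have c11 : c1 ** c1 = c1 by rewrite -{2}f1c cf1 f1c.
have c22 : c2 ** c2 = c2 by rewrite -{2}f2c cf2 f2c.
have f12 x y : f1 x ** f2 y = 0.
  by rewrite -fc1 -cf2 smulA -(smulA (f1 x)) c12 smulr0 smul0.
have f21 x y : f2 x ** f1 y = 0.
  by rewrite -fc2 -cf1 smulA -(smulA (f2 x)) c21 smulr0 smul0.
split.
- move=> [x1 x2] [y1 y2]; rewrite /corner_sum /= => E.
  have cf12 y : c1 ** f2 y = 0 by rewrite -cf2 smulA c12 smul0.
  have := congr1 (smul c1) E; rewrite !smulDr !cf1 !cf12 !addr0.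
  move/inj1 => xy1; congr pair => //; apply: inj2.
  by move: E; rewrite xy1 => /addrI.
- move=> [x1 x2] [y1 y2]; rewrite -[LHS]/(f1 (x1 ** y1) + f2 (x2 ** y2)) M1 M2.
  by rewrite /corner_sum /= smulDl !smulDr f12 f21 addr0 add0r.
- move=> i x; rewrite -[_ \in hpart i]/(x \in prod_part D1 D2 i) prod_partE.
  by case/andP=> x1 x2; rewrite rpredD ?g1 ?g2.
- by rewrite -[LHS]/(f1 sone + f2 sone) f1c f2c.
move=> a; rewrite smulDl => aE.
have [|d1 d1E] := s1 (c1 ** a); first by rewrite smulA c11.
have [|d2 d2E] := s2 (c2 ** a); first by rewrite smulA c22.
by exists (d1, d2); rewrite /corner_sum /= -d1E -d2E aE.
Qed.

End CornerSum.

Section Corner.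

Variable K : fieldType.

(** [cf_iso] relative to idempotents: D is identified with the summand of C cut out by e and
    [tau_dn C e]. For e = [sone] the summand is all of C. *)
Definition cf_embedding (D C : cf_data K) (e : bulk C) : Prop :=
  exists (f : {linear bulk D -> bulk C}) (g : {linear bdry D -> bdry C}),
    [/\ corner_embedding e f, corner_embedding (tau_dn C e) g,
        (forall a, theta_bulk C (f a) = theta_bulk D a)
          /\ (forall b, theta_bdry C (g b) = theta_bdry D b),
        forall b, tau_up C (g b) = f (tau_up D b)
      & forall a, tau_dn C (f a) = g (tau_dn D a)].

Lemma cf_embedding_zero (C : cf_data K) : cf_embedding (cf_zero K) (0 : bulk C).
Proof.
exists \0, \0; split=> //=; try by move=> *; rewrite ?linear0.
- split=> //=; first by move=> x y _; apply/matrixP => -[].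
  + by move=> x y; rewrite smul0.
  + by move=> i x _; rewrite mem0v.
  + by move=> a; rewrite smul0 => <-; exists 0.
- split=> //=; first by move=> x y _; apply/matrixP => -[].
  + by move=> x y; rewrite smul0.
  + by move=> i x _; rewrite mem0v.
  + by rewrite linear0.
  + by move=> a; rewrite linear0 smul0 => <-; exists 0.
Qed.

Lemma cf_embedding_sum (C D1 D2 : cf_data K) (e1 e2 : bulk C) :
  unital_morph (tau_dn C) -> e1 ** e2 = 0 -> e2 ** e1 = 0 ->
  cf_embedding D1 e1 -> cf_embedding D2 e2 -> cf_embedding (cf_sum D1 D2) (e1 +
    e2).
Proof.
move=> [_ tM] e12 e21 [f1 [g1 [f1e g1e [ta1 tb1] up1 dn1]]].
move=> [f2 [g2 [f2e g2e [ta2 tb2] up2 dn2]]].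
exists (corner_sum f1 f2), (corner_sum g1 g2); split.
- exact: corner_sum_embedding.
- by rewrite linearD; apply: corner_sum_embedding; rewrite //
  -tM ?e12 ?e21 linear0.
- split=> x; rewrite linearD /=.
    by rewrite ta1 ta2.
  by rewrite tb1 tb2.
- by move=> x; rewrite linearD /= up1 up2.
by move=> x; rewrite linearD /= dn1 dn2.
Qed.

Lemma cf_embedding_dsum (P : cf_data K -> Prop) (C : cf_data K) (es :
  seq (bulk C)) :
  unital_morph (tau_dn C) -> pairwise (@orthogonal _ (bulk C)) es ->
  {in es, forall e : bulk C, exists2 D, P D & cf_embedding D e} ->
  exists2 s, List.Forall P s & cf_embedding (cf_dsum s) (\sum_(e <- es) e).
Proof.
move=> tdn; elim: es => [|e es IH] /=.
  by move=> _ _; exists [::]; rewrite ?big_nil //; exact: cf_embedding_zero.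
case/andP=> /allP ort ortes emb.
have [|s Ps embs] := IH ortes; first by move=> x xes; apply: emb;
  rewrite inE xes orbT.
have [D PD embD] := emb e (mem_head _ _).
exists (D :: s); first by constructor.
rewrite big_cons; apply: cf_embedding_sum => //.
  by rewrite smul_sumr big_seq big1 // => x /ort/andP[/eqP].
by rewrite smul_suml big_seq big1 // => x /ort/andP[_ /eqP].
Qed.

End Corner.

Lemma cf_embedding_iso (K : closedFieldType) (C D : cf_data K) :
  tau_dn C sone = sone -> cf_embedding D (sone : bulk C) -> cf_iso C D.
Proof.
move=> t1 [f [g [fe ge [ta tb] up dn]]]; rewrite t1 in ge.
have bij (A B : superAlgType K) (h : {linear A -> B}) :
    corner_embedding sone h ->
    exists h' : {linear B -> A}, [/\ cancel h h', cancel h' h, bijective h',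
      unital_morph h'
      & graded_map h'].
  case=> [inj hM hg h1 sur]; apply: superalg_iso_inv => //.
  pose hl := linfun h.
  have hl_inj : lker hl == 0%VS by apply/lker0P => x y; rewrite !lfunE => /inj.
  have hK : cancel h hl^-1%VF by move=> x; have := lker0_lfunK hl_inj x;
    rewrite lfunE.
  exists hl^-1%VF => // y; have [|d ->] := sur y; first exact: smul1l.
  by rewrite hK.
have [f' [fK f'K fb fM fg]] := bij _ _ f fe.
have [g' [gK g'K gb gM gg]] := bij _ _ g ge.
exists f', g'; split=> //.
- by split=> x; [rewrite -ta f'K | rewrite -tb g'K].
- by move=> b; apply: (can_inj fK); rewrite f'K -up g'K.
by move=> a; apply: (can_inj gK); rewrite g'K -dn f'K.
Qed.

(** * The elementary summand attached to a bulk idempotent *)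

Section Elementary.

Variables (K : closedFieldType) (C : cf_data K) (e : bulk C).
Hypotheses (char_not2 : 2%:R != 0 :> K) (scf : super_cardy_frobenius C)
  (e_split : split_idempotent e)
  (bulk_comm : forall a b : bulk C, a ** b = b ** a).

Let c : bdry C := tau_dn C e.
Let lambda : K := theta_bulk C e.

(** Since e A = K e, lambda = 0 would put e in the radical of the form. *)
Lemma theta_split_neq0 : lambda != 0.
Proof.
have [_ e0 _ el] := e_split; apply: contra e0 => /eqP l0; apply/eqP.
apply: (scf_bulk_form scf).1 => a; have [k ->] := el a.
by rewrite linearZ /= -/lambda l0 mulr0.
Qed.

Let c_central b : c ** b = b ** c. Proof. exact: scf_dn_central. Qed.
Let c_even : c \in hpart false.
Proof. by apply: (scf_dn_graded scf); case: e_split. Qed.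
Let c_idem : c ** c = c.
Proof. by rewrite /c -(scf_dn_morph scf).2; case: e_split => _ _ ->. Qed.

(** Adjointness turns c b = b into e tau^*(b) = tau^*(b), a multiple k e; pairing it with the unit
    gives theta_B(b) = k lambda. *)
Lemma tau_up_corner b : c ** b = b ->
  tau_up C b = (theta_bdry C b / lambda) *: e.
Proof.
move=> cb; have [_ _ _ el] := e_split.
have eb : e ** tau_up C b = tau_up C b.
  apply/eqP; rewrite -subr_eq0; apply/eqP; apply: (scf_bulk_form scf).1 => a.
  rewrite bulk_comm smulBr linearB /= smulA -!(scf_adjoint scf).
  by rewrite (scf_dn_morph scf).2 -smulA -/c cb subrr.
have [k kE] := el (tau_up C b); rewrite eb in kE.
suff -> : theta_bdry C b = k * lambda by rewrite mulfK ?theta_split_neq0.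
rewrite -[b in LHS]smul1l -(scf_dn_morph scf).1 (scf_adjoint scf) smul1l kE.
by rewrite linearZ.
Qed.

Lemma cardy_corner X Y : c ** X = X -> c ** Y = Y ->
  theta_bdry C X * theta_bdry C Y / lambda = str (linfun (cardy_fun X Y)).
Proof.
move=> cX cY; rewrite -(scf_cardy scf) !tau_up_corner //.
have [_ _ ee _] := e_split.
rewrite -sscalerAl -sscalerAr ee scalerA linearZ /= -/lambda.
have l0 := theta_split_neq0.
by rewrite -[RHS]mulrA divfK // mulrAC.
Qed.

(** Nondegeneracy is given in the first argument; for homogeneous Y, supersymmetry carries it over
    to the second. *)
Lemma bdry_form_left j (Y : bdry C) : Y \in hpart j ->
  (forall b, theta_bdry C (b ** Y) = 0) -> Y = 0.
Proof.
have [nd sym] := scf_bdry_form scf.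
move=> Yj bY; apply: nd => b; rewrite -(hproj_sum b) smulDr linearD /=.
by rewrite !(sym _ _ _ _ Yj (hprojP _ b)) !bY !mulr0 addr0.
Qed.

(* If Y B X = 0 then m_{Xb, b'Y} = 0 for all b, b', so by the Cardy condition
   theta (Xb) theta (b'Y) = 0. *)
Lemma bdry_prime : graded_prime c.
Proof.
move=> i j X Y Xi Yj cX cY YfX; have [nd _] := scf_bdry_form scf.
case: (classic (X = 0)) => [|X0]; [by left | right].
case: (classic (exists b, theta_bdry C (X ** b) != 0)) => [[b Xb]|no];
  last first.
  case: X0; apply: nd => b; apply/eqP/negPn/negP => Xb.
  by apply: no; exists b.
apply: (bdry_form_left Yj) => b'; apply/eqP.
have cXb : c ** (X ** b) = X ** b by rewrite smulA cX.
have cbY : c ** (b' ** Y) = b' ** Y by rewrite c_central -smulA -c_central cY.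
have := cardy_corner cXb cbY.
(* The components of X b and b' Y are X b_i and b'_j Y with homogeneous b_i, b'_j, so each summand
   contains some Y f X = 0. *)
have T0 f : cardy_fun (X ** b) (b' ** Y) f = 0.
  rewrite /cardy_fun big1 // => i' _; rewrite big1 // => j' _; rewrite big1 //
    => k _.
  rewrite (hprojMl _ _ Xi) (hprojMr _ _ Yj) smulA -(smulA _ Y) -(smulA _ (Y **
    _)).
  by rewrite YfX smulr0 smul0 scaler0.
rewrite (str_rank1 (phi0 := \0) (w0 := 0) (phi1 := \0) (w1 := 0)); last 2 first.
- by move=> f; rewrite lfunE /= T0 linear0 scaler0.
- by move=> f; rewrite lfunE /= T0 linear0 scaler0.
move/eqP; rewrite subrr !mulf_eq0 invr_eq0 (negPf Xb) (negPf theta_split_neq0).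
by rewrite orbF.
Qed.

Definition base_map (x : K^o) : bulk C := x *: e.
Fact base_map_linear : linear base_map.
Proof. by move=> a x y; rewrite /base_map scalerDl scalerA. Qed.
HB.instance Definition _ :=
  GRing.isLinear.Build K K^o (bulk C) _ base_map base_map_linear.

Lemma base_embedding : corner_embedding e base_map.
Proof.
have [ev e0 ee el] := e_split; split.
- move=> x y /eqP; rewrite -subr_eq0 -scalerBl scaler_eq0 (negPf e0) orbF
  subr_eq0.
  by move/eqP.
- by move=> x y; rewrite /base_map -sscalerAl -sscalerAr ee scalerA.
- move=> [] x; rewrite /base_map /hpart /=.
    by rewrite memv0 => /eqP->; rewrite scale0r mem0v.
  by rewrite rpredZ.
- exact: scale1r.
by move=> a ea; have [k aE] := el a; exists k; rewrite -ea aE.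
Qed.

Lemma theta_base a : theta_bulk C (base_map a) = base_form lambda a.
Proof. by rewrite /base_map linearZ /= mulrC. Qed.

Lemma elementary_embedding : exists2 D, elementary_cf D & cf_embedding D e.
Proof.
have l0 := theta_split_neq0.
case: (eqVneq c 0) => [c0|c_neq0].
  exists (cf_E1 lambda); first exact: Elementary1.
  exists base_map, \0; split=> //=.
  - exact: base_embedding.
  - rewrite -/c c0; split=> //=; first by move=> x y _; apply/matrixP => -[].
    + by move=> x y; rewrite smul0.
    + by move=> i x _; rewrite mem0v.
    + by move=> a; rewrite smul0 => <-; exists 0.
  - by split=> x; rewrite ?theta_base // linear0.
  - by move=> b; rewrite !linear0.
  by move=> a; rewrite /base_map linearZ /= -/c c0 scaler0.
(* [b] is the boundary idempotent generating a minimal left ideal; [e] denotes the bulk idempotent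
   here. *)
have [b [ev b0 bb cb [b_line b_odd]]] :=
  corner_structure c_central c_even c_idem c_neq0 bdry_prime.
have sym : supersymmetric (theta_bdry C) := (scf_bdry_form scf).2.
have dn_base a : tau_dn C (base_map a) = a *: c by rewrite /base_map linearZ.
(* The Cardy condition equates mu^2 / lambda with 1 or -2, which is nonzero, hence mu is nonzero. *)
have mu0 (x : K) : x ^+ 2 / lambda != 0 -> x != 0.
  by apply: contraNneq => ->; rewrite expr0n mul0r.
case: b_odd => [b_odd|[xi [xi_odd bxi xib xixi xi_line]]].
  have [g [ge gt]] := smat_embedding bdry_prime c_even c_central c_idem ev b0
    bb cb
    b_line b_odd.
  have := cardy_corner cb cb; rewrite (str_cardy_even ev b0 bb b_line b_odd)
    -expr2.
  set mu := theta_bdry C b => mu2.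
  have lmu : lambda = mu ^+ 2 by rewrite -[lambda]mul1r -mu2 divfK.
  exists (cf_E2 (\dim (ideal_part b false)) (\dim (ideal_part b true)) lambda
    mu).
    by apply: Elementary2 => //; apply: mu0; rewrite mu2 oner_eq0.
  have [_ gM _ g1 _] := ge.
  have cg x : c ** g x = g x by rewrite -g1 -gM smul1l.
  exists base_map, g; split=> //=.
  - exact: base_embedding.
  - by split=> x; rewrite ?theta_base // gt.
  - move=> x; rewrite tau_up_corner // gt // /base_map /scale_base.
    by rewrite mulrAC.
  move=> a; rewrite dn_base -g1 -linearZ; congr (g _).
  by rewrite /smat_unit -scalemx1.
have cxi : c ** xi = xi by rewrite -bxi smulA cb.
have [g [ge gt]] := qmat_embedding bdry_prime c_even c_central c_idem ev b0 bb
  cb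
  b_line xi_odd bxi xib xixi xi_line.
have := cardy_corner cxi cxi.
rewrite (str_cardy_odd ev b0 bb b_line xi_odd bxi xib xixi xi_line) -expr2.
set mu := theta_bdry C xi => mu2.
have lmu : lambda = - (mu ^+ 2 / 2%:R).
  have -> : mu ^+ 2 = - 2%:R * lambda by rewrite -mu2 divfK.
  by rewrite mulNr mulNr opprK mulrC mulKf.
exists (cf_E3 (\dim (ideal_part b false)) lambda mu).
  by apply: Elementary3 => //; apply: mu0; rewrite mu2 oppr_eq0.
have [_ gM _ g1 _] := ge.
have cg x : c ** g x = g x by rewrite -g1 -gM smul1l.
exists base_map, g; split=> //=.
- exact: base_embedding.
- by split=> x; rewrite ?theta_base // gt.
- move=> x; rewrite tau_up_corner // gt // /base_map /scale_base.
  by rewrite mulrAC.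
move=> a; rewrite dn_base -g1 -linearZ; congr (g _).
by congr pair; rewrite /= ?scaler0 // scalemx1.
Qed.

End Elementary.

Unset Implicit Arguments.

Theorem theorem3p1 (K : closedFieldType) (char_not2 : 2%:R != 0 :> K)
    (C : cf_data K) :
  super_cardy_frobenius C -> cf_semisimple C ->
  exists2 s : seq (cf_data K),
    List.Forall (@elementary_cf K) s & cf_iso C (cf_dsum s).
Proof.
move=> scf [ssA _].
have [es ess] := supercommutative_split char_not2 ssA (scf_comm scf).
have comm := split_commutative (scf_comm scf) ess.
have [sumes ides ortes] := ess.
have [e ees|s elems emb] := cf_embedding_dsum (P := @elementary_cf K)
    (scf_dn_morph scf) ortes.
  by apply: elementary_embedding => //; apply: ides.
exists s => //; apply: cf_embedding_iso; first exact: (scf_dn_morph scf).1.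
by rewrite -sumes.
Qed.
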